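(* Let $\mathbf{X}=(X_1,\ldots,X_N)^T$ be a vector of $N\in\mathbb{N}$ input random variables fulfilling Assumption 1 (stated in the context), let $y(\mathbf{X})\in L^2(\Omega,\mathcal{F},\mathbb{P})$, and for $m\in\mathbb{N}_0$ let $$y_m(\mathbf{X})=\sum_{l=0}^m\mathbf{C}_l^T\mathbf{\Psi}_l(\mathbf{X}),\qquad \mathbf{C}_l=\mathbb{E}[y(\mathbf{X})\mathbf{\Psi}_l(\mathbf{X})],$$ be its $m$th-order generalized PCE approximation. Then the means satisfy $$\mathbb{E}[y_m(\mathbf{X})]=\mathbb{E}[y(\mathbf{X})]=C_0,$$ where $C_0$ is the single element of $\mathbf{C}_0=(C_0)$, and the variances are $$\mathrm{var}[y_m(\mathbf{X})]=\sum_{l=1}^m\mathbf{C}_l^T\mathbf{C}_l\qquad\text{and}\qquad \mathrm{var}[y(\mathbf{X})]=\sum_{l\in\mathbb{N}}\mathbf{C}_l^T\mathbf{C}_l,$$ where the sum for $m=0$ is empty (zero). In particular $\mathrm{var}[y_m(\mathbf{X})]\to\mathrm{var}[y(\mathbf{X})]$ as $m\to\infty$.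
   Context: $\mathbb{N}=\{1,2,\ldots\}$, $\mathbb{N}_0=\{0,1,2,\ldots\}$. $(\Omega,\mathcal{F},\mathbb{P})$ is a complete probability space, $\mathbb{A}^N\subseteq\mathbb{R}^N$ is a bounded or unbounded subdomain, $\mathcal{B}^N$ is its Borel $\sigma$-algebra, and $\mathbb{E}$ is expectation. Here $y$ is a real-valued measurable function on $\mathbb{A}^N$, and $y(\mathbf{X})\in L^2(\Omega,\mathcal{F},\mathbb{P})$ means $\mathbb{E}[y^2(\mathbf{X})]<\infty$. Assumption 1. The random vector $\mathbf{X}:(\Omega,\mathcal{F})\to(\mathbb{A}^N,\mathcal{B}^N)$ (1) has an absolutely continuous joint distribution function and a continuous joint probability density function $f_{\mathbf{X}}$ with bounded or unbounded support $\mathbb{A}^N\subseteq\mathbb{R}^N$; (2) has absolute finite moments of all orders, i.e. $\int_{\mathbb{A}^N}|\mathbf{x}^{\mathbf{j}}|f_{\mathbf{X}}(\mathbf{x})d\mathbf{x}<\infty$ for all $\mathbf{j}\in\mathbb{N}_0^N$, where $\mathbf{x}^{\mathbf{j}}=x_1^{j_1}\cdots x_N^{j_N}$; (3) has a density $f_{\mathbf{X}}$ which either (a) has compact support, i.e. there is a compact subset $\mathbb{A}^N\subset\mathbb{R}^N$ with $\mathbb{P}(\mathbf{X}\in\mathbb{A}^N)=1$, or (b) is exponentially integrable, i.e. there is a real $\alpha>0$ with $\int_{\mathbb{A}^N}\exp(\alpha\|\mathbf{x}\|)f_{\mathbf{X}}(\mathbf{x})d\mathbf{x}<\infty$, where $\|\cdot\|$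 is an arbitrary norm. For $\mathbf{j}=(j_1,\ldots,j_N)\in\mathbb{N}_0^N$, $|\mathbf{j}|=j_1+\cdots+j_N$; $\Pi_m^N=\mathrm{span}\{\mathbf{x}^{\mathbf{j}}:|\mathbf{j}|\le m\}$. Let $K_{N,l}=\binom{N+l-1}{l}$ be the number of multi-indices with $|\mathbf{j}|=l$, listed in a chosen monomial order as $\mathbf{j}^{(1)},\ldots,\mathbf{j}^{(K_{N,l})}$, and let $\mathbf{x}_l=(\mathbf{x}^{\mathbf{j}^{(1)}},\ldots,\mathbf{x}^{\mathbf{j}^{(K_{N,l})}})^T$. Multivariate orthogonal polynomials consistent with $f_{\mathbf{X}}(\mathbf{x})d\mathbf{x}$: a family $\{P_{\mathbf{j}}:\mathbf{j}\in\mathbb{N}_0^N\}$ with $P_{\mathbf{0}}=1$ and $P_{\mathbf{j}}\in\Pi_{|\mathbf{j}|}^N$, such that for each $l$ the column vector $\mathbf{P}_l(\mathbf{x})=(P_{\mathbf{j}^{(1)}}(\mathbf{x}),\ldots,P_{\mathbf{j}^{(K_{N,l})}}(\mathbf{x}))^T$ satisfies $\int_{\mathbb{A}^N}\mathbf{x}_r\mathbf{P}_l^T(\mathbf{x})f_{\mathbf{X}}(\mathbf{x})d\mathbf{x}=\mathbf{0}$ for all $r<l$, and the matrix $\mathbf{S}_l=\int_{\mathbb{A}^N}\mathbf{x}_l\mathbf{P}_l^T(\mathbf{x})f_{\mathbf{X}}(\mathbf{x})d\mathbf{x}$ is invertible. Orthonormal polynomials: the polynomial moment matrix $\mathbf{G}_l=\mathbb{E}[\mathbf{P}_l(\mathbf{X})\mathbf{P}_l^T(\mathbf{X})]$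 is symmetric positive-definite; fix for each $l$ a non-singular whitening matrix $\mathbf{W}_l\in\mathbb{R}^{K_{N,l}\times K_{N,l}}$ with $\mathbf{W}_l^T\mathbf{W}_l=\mathbf{G}_l^{-1}$ (with $\mathbf{W}_0=[1]$, so $\mathbf{\Psi}_0=(1)$) and set $\mathbf{\Psi}_l(\mathbf{x})=\mathbf{W}_l\mathbf{P}_l(\mathbf{x})$. *)

(* Defs.v *)
From HB Require Import structures.
From mathcomp Require Import all_boot all_order all_algebra.
From mathcomp Require Import all_classical all_reals all_analysis.
From mathcomp Require Import measurable_realfun.

Set Implicit Arguments.
Unset Strict Implicit.
Unset Printing Implicit Defensive.

Import Order.TTheory GRing.Theory Num.Theory.
Import numFieldNormedType.Exports.

Local Open Scope classical_set_scope.
Local Open Scope ring_scope.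

HB.instance Definition _ (R : realType) (n : nat) :=
  @isMeasurable.Build (sigma_display (@open 'rV[R]_n)) 'rV[R]_n
    <<s @open 'rV[R]_n >>
    (@sigma_algebra0 _ setT _) (@sigma_algebraC _ _)
    (@sigma_algebra_bigcup _ setT _).

Section borel_rV.
Context {R : realType}.

Lemma open_measurable_rV n (A : set 'rV[R]_n) : open A -> measurable A.
Proof. by move=> oA; exact: sub_sigma_algebra. Qed.

Lemma measurable_coord n (i : 'I_n) :
  measurable_fun [set: 'rV[R]_n] (fun x => x ord0 i).
Proof.
apply: (measurability _ (RGenOpens.measurableE R)) => _ [_ [a [b ->]] <-].
rewrite setTI; apply: open_measurable_rV.
move/continuousP : (@coord_continuous R 1 n ord0 i); apply; exact: interval_open.
Qed.

Lemma measurable_fun_rV d (T : measurableType d) n (D : set T)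
    (f : T -> 'rV[R]_n) :
  (forall i, measurable_fun D (fun t => f t ord0 i)) -> measurable_fun D f.
Proof.
move=> mf mD.
apply: (@measurability _ _ _ _ D f (@open 'rV[R]_n)) => // _ [A oA <-].
pose box (q : 'rV[rat]_n) (k : nat) : set 'rV[R]_n :=
  [set x | forall i, `|ratr (q ord0 i) - x ord0 i| < k.+1%:R^-1].
pose F (m : nat) := if @unpickle ('rV[rat]_n * nat)%type m is Some (q, k)
  then (if pselect (box q k `<=` A) then box q k else set0) else set0.
have -> : D `&` f @^-1` A = \bigcup_m (D `&` f @^-1` F m).
  rewrite predeqE => t; split => [[Dt Aft]|[m _ [Dt Fmt]]]; last first.
    split=> //; move: Fmt; rewrite /preimage/= /F.
    case: unpickle => // -[q k]; case: pselect => [qA|_] //= ?; exact: qA.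
  have [e /= e0 eA] := (nbhs_ballP (f t) A).1 (open_nbhs_nbhs (conj oA Aft)).
  have [k ke] : exists k : nat, k.+1%:R^-1 < e / 2.
    have e20 : 0 < e / 2 by rewrite divr_gt0.
    exists (Num.truncn (e / 2)^-1).
    rewrite invf_plt ?posrE//; first exact: truncnS_gt.
  have hq i : exists q : rat, `|ratr q - f t ord0 i| < k.+1%:R^-1.
    have [||x [bx [q _ qx]]] := @dense_rat R (ball (f t ord0 i) k.+1%:R^-1).
      by exists (f t ord0 i); exact: ballxx.
      exact: ball_open.
    by exists q; rewrite qx distrC.
  pose q := \row_i xchoose (hq i).
  exists (pickle (q, k)) => //; split => //.
  rewrite /preimage/= /F pickleK; case: pselect => [_|nA] /=.
    by move=> i; rewrite mxE; exact: (xchooseP (hq i)).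
  exfalso; apply: nA => x bx; apply: eA; split=> // i j.
  rewrite ord1 /ball/= (splitr e).
  rewrite -(subrK (ratr (q ord0 j)) (f t ord0 j)) -addrA.
  apply: (le_lt_trans (ler_normD _ _)); apply: ltrD; apply: lt_trans ke.
    by rewrite distrC mxE; exact: (xchooseP (hq j)).
  exact: bx.
apply: bigcupT_measurable => m; rewrite /F.
case: unpickle => [[q k]|]; last by rewrite preimage_set0 setI0.
case: (pselect (box q k `<=` A)) => [?|?] /=; last first.
  by rewrite preimage_set0 setI0.
have -> : D `&` f @^-1` box q k = D `&` \big[setI/setT]_(i < n) (D `&`
    (fun t => f t ord0 i) @^-1` ball (ratr (q ord0 i) : R) k.+1%:R^-1).
  rewrite -bigcap_seq predeqE => t; split=> [[Dt bt]|[Dt bt]]; split=> //.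
    by move=> i _; split => //; exact: bt.
  by move=> i; have [] := bt i (mem_index_enum i).
apply: measurableI => //; apply: bigsetI_measurable => i _.
by apply: mf => //; apply: open_measurable; exact: ball_open.
Qed.

End borel_rV.

Section lebesgue_rV_cons.
Local Open Scope ereal_scope.
Context {R : realType} (n : nat).

Definition cons_rV (p : R * 'rV[R]_n) : 'rV[R]_n.+1 :=
  row_mx (const_mx p.1 : 'rV[R]_1) p.2.

Lemma measurable_cons_rV : measurable_fun [set: R * 'rV[R]_n] cons_rV.
Proof.
apply: measurable_fun_rV => i.
case: (@split_ordP 1 n i) => j ->.
  under eq_fun do rewrite /cons_rV (@row_mxEl R 1 1 n) mxE.
  exact: measurable_fst.
under eq_fun do rewrite /cons_rV (@row_mxEr R 1 1 n).
exact: (measurableT_comp (measurable_coord j)).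
Qed.

Variable mu : {sigma_finite_measure set 'rV[R]_n -> \bar R}.

Definition lebesgue_cons : set 'rV[R]_n.+1 -> \bar R :=
  pushforward (@lebesgue_measure R \x mu) cons_rV.

Let lebesgue_cons0 : lebesgue_cons set0 = 0.
Proof. by rewrite /lebesgue_cons /pushforward preimage_set0 measure0. Qed.

Let lebesgue_cons_ge0 A : 0 <= lebesgue_cons A.
Proof. by rewrite /lebesgue_cons /pushforward measure_ge0. Qed.

Let lebesgue_cons_sigma_additive : semi_sigma_additive lebesgue_cons.
Proof.
exact: (@measure_semi_sigma_additive _ _ _
  (measure_function_pushforward__canonical__measure_function_Measure
    (@lebesgue_measure R \x mu) measurable_cons_rV)).
Qed.

HB.instance Definition _ := isMeasure.Build _ _ _ lebesgue_cons
  lebesgue_cons0 lebesgue_cons_ge0 lebesgue_cons_sigma_additive.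

Let uncons_rV (x : 'rV[R]_n.+1) : R * 'rV[R]_n :=
  (x ord0 ord0, rsubmx (x : 'rV[R]_(1 + n))).

Let cons_rVK : cancel cons_rV uncons_rV.
Proof.
move=> [a x]; rewrite /uncons_rV /cons_rV row_mxKr; congr pair.
transitivity (row_mx (const_mx a : 'rV[R]_1) x ord0 (lshift n ord0)).
  by congr (row_mx _ _ _ _); exact: val_inj.
by rewrite row_mxEl mxE.
Qed.

Let measurable_uncons_rV : measurable_fun [set: 'rV[R]_n.+1] uncons_rV.
Proof.
apply: measurable_fun_pair; first exact: measurable_coord.
apply: measurable_fun_rV => i; under eq_fun do rewrite mxE.
exact: measurable_coord.
Qed.

Let lebesgue_cons_sigma_finite : sigma_finite setT lebesgue_cons.
Proof.
have /sigma_finiteP[F [FT ndF Foo]] := sigma_finiteT (@lebesgue_measure R).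
have /sigma_finiteP[G [GT ndG Goo]] := sigma_finiteT mu.
exists (fun k => uncons_rV @^-1` (F k `*` G k)).
  rewrite -preimage_bigcup (_ : \bigcup_k _ = setT) ?preimage_setT//.
  rewrite -subTset => -[x y] _.
  have [[k _ Fkx] [l _ Gly]] : (\bigcup_k F k) x /\ (\bigcup_k G k) y.
    by rewrite -FT -GT.
  exists (maxn k l) => //; split.
    by move: x Fkx; exact/subsetPset/ndF/leq_maxl.
  by move: y Gly; exact/subsetPset/ndG/leq_maxr.
move=> k; have [mF Fk] := Foo k; have [mG Gk] := Goo k; split.
  rewrite -[X in measurable X]setTI; apply: measurable_uncons_rV => //.
  exact: measurableX.
rewrite /lebesgue_cons /pushforward -comp_preimage.
rewrite (_ : _ \o _ = id); last by apply/funext => p; exact: cons_rVK.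
by rewrite preimage_id product_measure1E// lte_mul_pinfty// ge0_fin_numE.
Qed.

HB.instance Definition _ := Measure_isSigmaFinite.Build _ _ _ lebesgue_cons
  lebesgue_cons_sigma_finite.

End lebesgue_rV_cons.

(* Iterated product measure, splitting off the first coordinate; see
   [lebesgue_rV_box] for its value on boxes. *)
Fixpoint lebesgue_rV (R : realType) (n : nat) :
    {sigma_finite_measure set 'rV[R]_n -> \bar R} :=
  match n with
  | 0 => @dirac _ 'rV[R]_0 0 R
  | n'.+1 => lebesgue_cons (lebesgue_rV R n')
  end.

Lemma lebesgue_rV_box (R : realType) (n : nat) (B : 'I_n -> set R) :
  (forall i, measurable (B i)) ->
  lebesgue_rV R n [set x : 'rV[R]_n | forall i, B i (x ord0 i)] =
  (\prod_(i < n) lebesgue_measure (B i))%E.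
Proof.
elim: n B => [B _|n IH B mB].
  rewrite big_ord0 /= /dirac indicE.
  have -> : ((0 : 'rV[R]_0) \in
      [set x : 'rV[R]_0 | forall i, B i (x ord0 i)]) = true.
    by apply/mem_set; case.
  by [].
rewrite big_ord_recl /= /lebesgue_cons /pushforward.
rewrite (_ : _ @^-1` _ = B ord0 `*`
    [set x : 'rV[R]_n | forall i, B (lift ord0 i) (x ord0 i)]); last first.
  rewrite predeqE => -[a x]; rewrite /preimage /cons_rV /=; split=> [h|[h0 h] i].
    split.
      have := h (lshift n (ord0 : 'I_1)); rewrite (@row_mxEl R 1 1 n) mxE.
      by rewrite (_ : lshift n ord0 = ord0) //; exact: val_inj.
    move=> i; have := h (rshift 1 i); rewrite (@row_mxEr R 1 1 n).
    by rewrite (_ : rshift 1 i = lift ord0 i) //; exact: val_inj.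
  case: (@split_ordP 1 n i) => j ->.
    rewrite (@row_mxEl R 1 1 n) mxE.
    by rewrite ord1 (_ : lshift n ord0 = ord0) //; exact: val_inj.
  rewrite (@row_mxEr R 1 1 n); have := h j.
  by rewrite (_ : rshift 1 j = lift ord0 j) //; exact: val_inj.
have mS : measurable
    [set x : 'rV[R]_n | forall i, B (lift ord0 i) (x ord0 i)].
  rewrite [X in measurable X](_ : _ = \big[setI/setT]_(i < n)
      ((fun x : 'rV[R]_n => x ord0 i) @^-1` B (lift ord0 i))).
    apply: bigsetI_measurable => i _; rewrite -[X in measurable X]setTI.
    by apply: measurable_coord => //; exact: mB.
  rewrite -bigcap_seq predeqE => x; split=> [h i _|h i]; first exact: h.
  exact: (h i (mem_index_enum i)).
rewrite product_measure1E ?(IH (fun i => B (lift ord0 i)))//.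
exact: (mB ord0).
Qed.

Section multi_indices.
Context {R : realType} {N : nat}.

Definition multi_index := {ffun 'I_N -> nat}.

Definition mdegree (j : multi_index) : nat := (\sum_(i < N) j i)%N.

Definition monomial (j : multi_index) (x : 'rV[R]_N) : R :=
  \prod_(i < N) x ord0 i ^+ j i.

Definition poly_space (m : nat) : set ('rV[R]_N -> R) :=
  [set p | exists (s : seq multi_index) (c : multi_index -> R),
    (forall j, j \in s -> (mdegree j <= m)%N) /\
    forall x, p x = \sum_(j <- s) c j * monomial j x].

Definition monomial_order (le : rel multi_index) : Prop :=
  [/\ total le, antisymmetric le, transitive le,
      forall j, le 0 j & forall i j k, le i j -> le (i + k) (j + k)].

End multi_indices.
Arguments multi_index N : clear implicits.
Arguments poly_space {R N} m.

(* For N > 0, the number of multi-indices of total degree l; the subtraction is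
   truncated, so the formula is only meaningful in that case. *)
Definition nb_idx (N l : nat) : nat := 'C(N + l - 1, l).

Lemma nb_idx0 N : nb_idx N 0 = 1%N.
Proof. exact: bin0. Qed.

(* [mi l] lists the multi-indices of total degree l in the order [le]. *)
Definition graded_listing N (le : rel (multi_index N))
    (mi : forall l, 'I_(nb_idx N l) -> multi_index N) : Prop :=
  forall l, [/\ forall i, mdegree (mi l i) = l,
                forall j, mdegree j = l -> exists i, mi l i = j,
                injective (mi l) &
                forall i k : 'I_(nb_idx N l), (i <= k)%N ->
                  le (mi l i) (mi l k)].

Section weighted_polynomials.
Context {R : realType} {N : nat}.
Variable mi : forall l, 'I_(nb_idx N l) -> multi_index N.
Arguments mi : clear implicits.

Definition degree_col (F : multi_index N -> 'rV[R]_N -> R) (l : nat)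
    (x : 'rV[R]_N) : 'cV[R]_(nb_idx N l) :=
  \col_i F (mi l i) x.

Definition integral_mx (A : set 'rV[R]_N) (f : 'rV[R]_N -> R) (p q : nat)
    (M : 'rV[R]_N -> 'M[R]_(p, q)) : 'M[R]_(p, q) :=
  \matrix_(i, k) \int[lebesgue_rV R N]_(x in A) (M x i k * f x).

Definition orthogonal_polynomials (A : set 'rV[R]_N) (f : 'rV[R]_N -> R)
    (P : multi_index N -> 'rV[R]_N -> R) : Prop :=
  [/\ P 0 = cst 1,
      forall j, poly_space (mdegree j) (P j),
      forall l r, (r < l)%N ->
        integral_mx A f (fun x => degree_col monomial r x *m
                                  (degree_col P l x)^T) = 0 &
      forall l, integral_mx A f (fun x => degree_col monomial l x *m
                                  (degree_col P l x)^T) \in unitmx].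

End weighted_polynomials.

Definition is_norm (R : realType) (n : nat) (nrm : 'rV[R]_n -> R) : Prop :=
  [/\ forall x, nrm x = 0 -> x = 0,
      forall a x, nrm (a *: x) = `|a| * nrm x &
      forall x z, nrm (x + z) <= nrm x + nrm z].

(* The values of [f] outside [A] are irrelevant: [f] stands for a density
   A -> [0, oo[, whose support is A up to boundary points, so that A may be
   open or compact. As all norms on R^N are equivalent, the choice of [nrm] in
   the exponential integrability condition only affects [alpha]. *)
Record admissible_input (R : realType) (d : measure_display)
    (T : measurableType d) (Pr : probability T R) (N : nat)
    (X : {RV Pr >-> 'rV[R]_N}) (A : set 'rV[R]_N) (f : 'rV[R]_N -> R)
    : Prop := {
  domain_measurable : measurable A ;
  input_in_domain : forall w, A (X w) ;
  law_absolutely_continuous : distribution Pr X `<< lebesgue_rV R N ;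
  density_ge0 : forall x, A x -> 0 <= f x ;
  density_continuous : {within A, continuous f} ;
  density_support : A `<=` closure [set x | A x /\ f x != 0] ;
  density_law : forall B, measurable B ->
    distribution Pr X B =
      (\int[lebesgue_rV R N]_(x in A `&` B) (f x)%:E)%E ;
  finite_moments : forall j : multi_index N,
    (\int[lebesgue_rV R N]_(x in A) (`|monomial j x| * f x)%:E < +oo)%E ;
  compact_or_exp_integrable :
    (exists K : set 'rV[R]_N, compact K /\ Pr (X @^-1` K) = 1%E) \/
    (exists nrm : 'rV[R]_N -> R, is_norm nrm /\
     exists2 alpha : R, 0 < alpha &
       (\int[lebesgue_rV R N]_(x in A) (expR (alpha * nrm x) * f x)%:E
          < +oo)%E)
}.

Section chaos_expansion.
Context {R : realType} {d : measure_display} {T : measurableType d}.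
Context (Pr : probability T R) {N : nat} (X : T -> 'rV[R]_N).
Variable mi : forall l, 'I_(nb_idx N l) -> multi_index N.
Variable P : multi_index N -> 'rV[R]_N -> R.
Variable W : forall l, 'M[R]_(nb_idx N l).
Variable y : 'rV[R]_N -> R.
Arguments mi : clear implicits.

Definition expectation_mx (p q : nat) (M : T -> 'M[R]_(p, q)) : 'M[R]_(p, q) :=
  \matrix_(i, k) fine 'E_Pr[fun w => M w i k].

Definition moment_mx (l : nat) : 'M[R]_(nb_idx N l) :=
  expectation_mx (fun w => degree_col mi P l (X w) *m
                           (degree_col mi P l (X w))^T).

Definition whitening : Prop :=
  W 0 = 1%:M /\
  forall l, W l \in unitmx /\ (W l)^T *m W l = invmx (moment_mx l).

Definition orthonormal_col (l : nat) (x : 'rV[R]_N) : 'cV[R]_(nb_idx N l) :=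
  W l *m degree_col mi P l x.

Definition pce_coef (l : nat) : 'cV[R]_(nb_idx N l) :=
  expectation_mx (fun w => y (X w) *: orthonormal_col l (X w)).

Definition pce (m : nat) (x : 'rV[R]_N) : R :=
  \sum_(l < m.+1) ((pce_coef l)^T *m orthonormal_col l x) ord0 ord0.

Definition pce_coef0 : R :=
  pce_coef 0 (cast_ord (esym (nb_idx0 N)) ord0) ord0.

Definition pce_energy (l : nat) : R := ((pce_coef l)^T *m pce_coef l) ord0 ord0.

End chaos_expansion.

(* Main.v *)
Require Import Defs.
From HB Require Import structures.
From mathcomp Require Import all_boot all_order all_algebra.
From mathcomp Require Import all_classical all_reals all_analysis.
From mathcomp Require Import measurable_realfun ring lra.

(** The components of Psi_0, Psi_1, ... are orthonormal in L2: those of distinct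
    degrees because P_l is orthogonal to every polynomial of lower degree, those
    of the same degree because W_l G_l W_l^T = 1. Since Psi_0 = 1, the zeroth
    coefficient is the mean of y(X), and E[y_m^2] is the sum of the squared
    coefficients up to degree m; this gives the mean and the variance of y_m.
    All that remains is Parseval's identity for y(X), that is, the completeness of
    the family ([cvg_partial_energy]): the second moment of y(X) must be the
    sum of all the squared coefficients.

    Completeness has two ingredients. First, Psi_0, ..., Psi_m span the
    polynomials of degree at most m ([monomial_chaos_span]): the invertibility
    of the moment matrices makes the leading parts of the P_j of each degree
    invertible. As the truncated expansion y_m is the best approximation of y
    in that span ([sqdist_orthonormal_sum]), it then suffices, second, to
    approximate y(X) in L2 by polynomials in X ([input_polynomials_dense]).

    The density of polynomials rests on exponential integrability, through
    bounded multipliers. Call a bounded function h a multiplier if h p lies in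
    the L2 closure of the polynomials for each polynomial p. Multipliers form an
    algebra, closed under bounded pointwise limits, so the events whose
    indicator is a multiplier form a sigma-algebra
    ([sigma_algebra_multiplier_event]), for which every multiplier is measurable
    ([multiplier_event_gt]). If t is small, sin (t X_i) is a multiplier, because
    its Taylor sums times p are dominated by exp (t |X_i|) |p|, which is square
    integrable ([multiplier_sin]). Letting t tend to 0 in sin (t X_i) / t, the
    coordinates X_i themselves are measurable for that sigma-algebra, which
    therefore contains all events determined by X. Indicators of such events,
    and by approximation all square integrable functions of X, belong to the
    closure of the polynomials ([L2closure_full]). *)

Set Implicit Arguments.
Unset Strict Implicit.
Unset Printing Implicit Defensive.

Import Order.TTheory GRing.Theory Num.Theory.
Import numFieldNormedType.Exports.

Local Open Scope classical_set_scope.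
Local Open Scope ring_scope.

(** * L2 closure of a family of functions *)

Section L2_closure.
Local Open Scope ereal_scope.
Context {R : realType} {d : measure_display} {T : measurableType d}.
Variable Pr : probability T R.
Implicit Types (f g h p : T -> R) (V : set (T -> R)).

Lemma Lfun2P f : f \in Lfun Pr 2%:E <->
  measurable_fun setT f /\ \int[Pr]_w ((f w ^+ 2)%R)%:E < +oo.
Proof.
split=> [f2|[mf f2]].
  have mf : measurable_fun setT f by move: f2; rewrite inE => /andP[/[!inE]].
  split=> //; have /integrableP[_] := Lfun2_integrable_sqr f2.
  by under eq_integral do rewrite /= ger0_norm ?sqr_ge0//.
rewrite inE; apply/andP; split; rewrite inE//=.
rewrite /finite_norm unlock poweR_lty//.
apply: le_lt_trans f2; apply: ge0_le_integral => //.
- by move=> w _; rewrite poweR_ge0.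
- apply: (measurableT_comp (measurable_poweR _)) => //.
  by apply: measurableT_comp => //; exact/measurable_EFinP.
- by apply/measurable_EFinP; exact: measurable_funX.
by move=> w _; rewrite /= lee_fin powR_mulrn// real_normK// num_real.
Qed.

Lemma Lfun2_measurable f : f \in Lfun Pr 2%:E -> measurable_fun setT f.
Proof. by move/Lfun2P => []. Qed.

Definition sqdist f g : \bar R := \int[Pr]_w (((f w - g w) ^+ 2)%R)%:E.

(** From (a + b)^2 <= 2 a^2 + 2 b^2: this replaces the triangle inequality
    without the square roots. *)
Lemma sqdist_le f g h : measurable_fun setT f -> measurable_fun setT g ->
  measurable_fun setT h ->
  sqdist f h <= 2%:E * sqdist f g + 2%:E * sqdist g h.
Proof.
move=> mf mg mh; rewrite /sqdist.
have m f' g' : measurable_fun setT f' -> measurable_fun setT g' ->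
    measurable_fun setT (fun w => ((f' w - g' w) ^+ 2)%:E : \bar R).
  move=> mf' mg'; apply/measurable_EFinP.
  by apply: measurable_funX; exact: measurable_funB.
rewrite -!ge0_integralZl ?lee_fin//; last 4 first.
- exact: m.
- by move=> w _; rewrite lee_fin sqr_ge0.
- exact: m.
- by move=> w _; rewrite lee_fin sqr_ge0.
rewrite -ge0_integralD//; last 4 first.
- by move=> w _; rewrite mule_ge0// lee_fin ?sqr_ge0.
- by apply: measurable_funeM; exact: m.
- by move=> w _; rewrite mule_ge0// lee_fin ?sqr_ge0.
- by apply: measurable_funeM; exact: m.
apply: ge0_le_integral => //.
- by move=> w _; rewrite lee_fin sqr_ge0.
- exact: m.
- by apply: emeasurable_funD; apply: measurable_funeM; exact: m.
move=> w _; rewrite -!EFinM -EFinD lee_fin.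
have := sqr_ge0 ((f w - g w) - (g w - h w)); lra.
Qed.

Lemma sqdistxx f : sqdist f f = 0.
Proof.
rewrite /sqdist; under eq_integral do rewrite subrr expr0n.
by rewrite integral0.
Qed.

(** The closure is taken among functions and not among classes modulo
    almost-everywhere equality, so that pointwise limits apply to its members. *)
Definition L2closure V : set (T -> R) :=
  [set g | measurable_fun setT g /\
    forall e : R, (0 < e)%R -> exists2 p, V p & sqdist g p < e%:E].

Section fixed_family.
Variable V : set (T -> R).
Hypothesis V_L2 : forall p, V p -> p \in Lfun Pr 2%:E.

Let mV p : V p -> measurable_fun setT p.
Proof. by move/V_L2/Lfun2_measurable. Qed.

Lemma sub_L2closure p : V p -> L2closure V p.
Proof.
move=> Vp; split; first exact: mV.
by move=> e e0; exists p => //; rewrite sqdistxx lte_fin.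
Qed.

Lemma L2closure_approx g : measurable_fun setT g ->
  (forall e : R, (0 < e)%R -> exists2 h, L2closure V h & sqdist g h < e%:E) ->
  L2closure V g.
Proof.
move=> mg gV; split=> // e e0.
have e4 : (0 < e / 4)%R by rewrite divr_gt0.
have [h [mh hV] gh] := gV _ e4; have [p Vp hp] := hV _ e4.
exists p => //; apply: le_lt_trans (sqdist_le mg mh (mV Vp)) _.
rewrite (_ : e = 2 * (e / 4) + 2 * (e / 4))%R; last by field.
rewrite [ltRHS]EFinD; apply: lteD; rewrite [ltRHS]EFinM lte_pmul2l//.
Qed.

(** Dominated convergence for (g - g_n)^2 <= 4 D^2 makes the distance from g
    to g_n tend to 0. *)
Lemma L2closure_cvg (g_ : nat -> T -> R) g D :
  (forall n, L2closure V (g_ n)) -> (forall w, g_ n w @[n --> \oo] --> g w) ->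
  D \in Lfun Pr 2%:E -> (forall n w, `|g_ n w| <= D w)%R ->
  L2closure V g.
Proof.
move=> gV gg D2 gD.
have mg_ n : measurable_fun setT (g_ n) by have [] := gV n.
have mg : measurable_fun setT g.
  by apply: (measurable_fun_cvg (h := g_)) => // w _; exact: gg.
apply: L2closure_approx => // e e0.
have gleD w : (`|g w| <= D w)%R.
  have cg : `|g_ n w|%R @[n --> \oo] --> `|g w|%R by apply: cvg_norm; exact: gg.
  rewrite -(cvg_lim _ cg)//; apply: limr_le.
    by apply/cvg_ex; exists `|g w|%R.
  by apply: nearW => n; exact: gD.
have : (fun n => sqdist g (g_ n)) @ \oo --> 0.
  have [|||||_ _] := @dominated_convergence _ _ _ Pr setT measurableT
    (fun n w => ((g w - g_ n w) ^+ 2)%:E) (cst 0) (fun w => (4 * D w ^+ 2)%:E).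
  - move=> n; apply/measurable_EFinP.
    by apply: measurable_funX; exact: measurable_funB.
  - exact: measurable_cst.
  - apply: aeW => w _; apply: cvg_EFin; first exact: nearW.
    rewrite [X in _ --> X](_ : _ = ((g w - g w) * (g w - g w))%R);
      last by rewrite subrr mulr0.
    under eq_fun do rewrite /= expr2.
    by apply: cvgM; apply: cvgB; (exact: cvg_cst || exact: gg).
  - under eq_fun do rewrite EFinM.
    by apply: integrableZl => //; exact: Lfun2_integrable_sqr.
  - apply: aeW => w n _; rewrite /= lee_fin ger0_norm ?sqr_ge0//.
    have := gD n w; have := gleD w; rewrite !ler_norml => /andP[? ?] /andP[? ?].
    have : (0 <= (2 * D w - (g w - g_ n w)) * (2 * D w + (g w - g_ n w)))%R.
      by apply: mulr_ge0; lra.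
    lra.
  by under [X in _ --> X]eq_integral do rewrite /cst; rewrite integral0.
move=> /fine_cvgP[fin] /cvgr0Pnorm_lt /(_ _ e0) small.
near \oo => n.
exists (g_ n) => //.
have nfin : sqdist g (g_ n) \is a fin_num by near: n.
rewrite -(fineK nfin) lte_fin.
apply: le_lt_trans (ler_norm _) _.
by near: n; exact: small.
Unshelve. all: by end_near. Qed.


Lemma L2closureZ a g : (forall b p, V p -> V (b \o* p)) ->
  L2closure V g -> L2closure V (a \o* g).
Proof.
move=> VZ [mg gV]; split; first exact: measurable_funM.
move=> e e0; have e'0 : (0 < e / (a ^+ 2 + 1))%R.
  by rewrite divr_gt0// ltr_wpDl// sqr_ge0.
have [p Vp gp] := gV _ e'0; exists (a \o* p); first exact: VZ.
rewrite (_ : sqdist _ _ = (a ^+ 2)%:E * sqdist g p); last first.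
  rewrite /sqdist -ge0_integralZl//.
  - by apply: eq_integral => w _; rewrite /= -mulrBl exprMn EFinM muleC.
  - apply/measurable_EFinP; apply: measurable_funX; apply: measurable_funB => //.
    exact: mV.
  - by move=> w _; rewrite lee_fin sqr_ge0.
  - by rewrite lee_fin sqr_ge0.
apply: (@le_lt_trans _ _ ((a ^+ 2)%:E * (e / (a ^+ 2 + 1))%:E)).
  by rewrite lee_wpmul2l ?lee_fin ?sqr_ge0// ltW.
rewrite -EFinM lte_fin mulrCA gtr_pMr// ltr_pdivrMr ?mul1r ?ltrDl//.
by rewrite ltr_wpDl// sqr_ge0.
Qed.

Lemma L2closureD g h : (forall p q, V p -> V q -> V (p \+ q)%R) ->
  L2closure V g -> L2closure V h -> L2closure V (g \+ h)%R.
Proof.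
move=> VD [mg gV] [mh hV]; split; first exact: measurable_funD.
move=> e e0; have e4 : (0 < e / 4)%R by rewrite divr_gt0.
have [p Vp gp] := gV _ e4; have [q Vq hq] := hV _ e4.
exists (p \+ q)%R; first exact: VD.
have mp := mV Vp; have mq := mV Vq.
apply: (le_lt_trans (@sqdist_le _ (p \+ h)%R _ _ _ _)).
- exact: measurable_funD.
- exact: measurable_funD.
- exact: measurable_funD.
rewrite (_ : e = 2 * (e / 4) + 2 * (e / 4))%R; last by field.
rewrite [ltRHS]EFinD; apply: lteD; rewrite [ltRHS]EFinM lte_pmul2l//.
  apply: le_lt_trans gp; rewrite le_eqVlt; apply/orP; left; apply/eqP.
  by apply: eq_integral => w _ /=; congr ((_ ^+ 2)%:E); ring.
apply: le_lt_trans hq; rewrite le_eqVlt; apply/orP; left; apply/eqP.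
by apply: eq_integral => w _ /=; congr ((_ ^+ 2)%:E); ring.
Qed.

End fixed_family.
End L2_closure.

(** * Two pointwise limits *)

Section polynomial_indicator.
Context {R : realType}.
Implicit Types u r : R.

Lemma bernoulli_inequality u k : 0 <= u <= 1 -> 1 - k%:R * u <= (1 - u) ^+ k.
Proof.
move=> /andP[u0 u1]; elim: k => [|k IH]; first by rewrite mul0r subr0 expr0.
apply: (@le_trans _ _ ((1 - u) * (1 - k%:R * u))); last first.
  by rewrite exprS ler_wpM2l// subr_ge0.
have : 0 <= k%:R * (u * u) by rewrite !mulr_ge0.
rewrite -natr1; lra.
Qed.

(** If s is the square root of r, then n s^n is at most the geometric sum
    1 / (1 - s), so n r^n = (n s^n) s^n is bounded by a multiple of s^n. *)
Lemma cvg_natr_expr r : 0 <= r < 1 -> n%:R * r ^+ n @[n --> \oo] --> (0 : R).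
Proof.
move=> /andP[r0 r1]; set s := Num.sqrt r.
have s0 : 0 <= s by exact: sqrtr_ge0.
have s1 : s < 1 by rewrite -sqrtr1 ltr_sqrt.
have rs : r = s * s by rewrite -expr2 sqr_sqrtr.
have sn : s ^+ n @[n --> \oo] --> (0 : R).
  by apply: cvg_expr; rewrite ger0_norm.
apply: (@squeeze_cvgr _ _ _ _ (fun=> 0) (fun n => (1 - s)^-1 * s ^+ n)).
- apply: nearW => n; rewrite mulr_ge0 ?exprn_ge0//= rs exprMn mulrA.
  rewrite ler_wpM2r ?exprn_ge0// -div1r ler_pdivlMr ?subr_gt0//.
  have sE : (1 - s) * \sum_(i < n) s ^+ i = 1 - s ^+ n.
    by rewrite -[RHS]opprB subrX1 -mulNr opprB.
  apply: (@le_trans _ _ (1 - s ^+ n)); last by rewrite gerBl exprn_ge0.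
  rewrite -sE mulrC ler_pM2l ?subr_gt0// mulr_natl -[X in _ *+ X]card_ord.
  rewrite -sumr_const; apply: ler_sum => i _.
  by apply: ler_wiXn2l; [exact: s0|exact: ltW|exact: ltnW].
- exact: cvg_cst.
- by rewrite -[X in _ --> X](mulr0 (1 - s)^-1); apply: cvgM => //; exact: cvg_cst.
Qed.

(** Polynomials with values in [0, 1] that converge on [0, 1] to the indicator of
    u < 1/2. Below 1/2, Bernoulli's inequality bounds the value below by
    1 - n (2u)^n; from 1/2 on, the value is at most exp (- n (2u)^n), hence at
    most exp (- n). The factor n in the exponent forces the limit 0 at 1/2. *)
Lemma cvg_polynomial_indicator u : 0 <= u <= 1 ->
  (1 - u ^+ n) ^+ (n * 2 ^ n) @[n --> \oo] --> ((u < 1 / 2)%R%:R : R).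
Proof.
move=> /andP[u0 u1]; have un n : 0 <= u ^+ n <= 1.
  by rewrite exprn_ge0//= exprn_ile1.
have [u12|u12] := ltP u (1 / 2).
  have r01 : 0 <= 2 * u < 1 by apply/andP; split; lra.
  have cr : 1 - n%:R * (2 * u) ^+ n @[n --> \oo] --> (1 : R).
    rewrite -[X in _ --> X](subr0 1); apply: cvgB; first exact: cvg_cst.
    exact: cvg_natr_expr.
  apply: (squeeze_cvgr _ cr (cvg_cst (1 : R))); apply: nearW => n.
  apply/andP; split.
    apply: le_trans (bernoulli_inequality _ (un n)).
    by rewrite natrM natrX exprMn mulrA.
  have /andP[? ?] := un n.
  by apply: exprn_ile1; [rewrite subr_ge0|rewrite gerBl].
apply: (squeeze_cvgr _ (cvg_cst (0 : R)) cvg_harmonic); apply: nearW => n.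
have /andP[? un1] := un n.
rewrite exprn_ge0 ?subr_ge0//=.
apply: (@le_trans _ _ (expR (- n%:R))).
  apply: (@le_trans _ _ (expR (- u ^+ n) ^+ (n * 2 ^ n))).
    by rewrite lerXn2r ?nnegrE ?subr_ge0 ?expR_ge0// expR_ge1Dx.
  rewrite -expRM_natr ler_expR mulNr lerN2 natrM natrX mulrCA -exprMn.
  by rewrite ler_peMr// exprn_ege1//; lra.
rewrite expRN /harmonic/= lef_pV2 ?posrE ?expR_gt0// -natr1 addrC.
exact: expR_ge1Dx.
Qed.

(** The limit is the derivative of sin (x h) with respect to h at 0. *)
Lemma cvg_sin_div (x t : R) : t != 0 ->
  (n.+1%:R / t) * sin (t / n.+1%:R * x) @[n --> \oo] --> x.
Proof.
move=> t0.
have gx : is_derive (0 : R) 1 (x \*: (@id R)) x.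
  by have := is_deriveZ x (is_derive_id (0 : R) 1); rewrite /GRing.scale/= mulr1.
have s1 : is_derive ((x \*: (@id R)) 0) 1 (@sin R) 1.
  by rewrite /= scaler0 -[X in is_derive _ _ _ X](@cos0 R); exact: is_derive_sin.
have [/cvg_ex[l cl] dl] := @is_derive1_comp _ _ _ _ _ _ s1 gx.
have lx : l = x by rewrite -[RHS]mul1r -dl /derive; apply/esym/cvg_lim.
have tn : t / n.+1%:R @[n --> \oo] --> (0 : R).
  rewrite -[X in _ --> X](mulr0 t); apply: cvgM; first exact: cvg_cst.
  exact: cvg_harmonic.
have tn0 : t / n.+1%:R @[n --> \oo] --> (0 : R)^'.
  move=> B B0; have [m _ mB] := tn _ B0; exists m => // n mn.
  by apply: (mB n mn); rewrite /= mulf_neq0// invr_neq0// pnatr_eq0.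
rewrite lx in cl.
have := cvg_comp _ _ tn0 cl.
apply: cvg_trans; apply: near_eq_cvg; apply: nearW => n /=.
by rewrite /GRing.scale /= mulr1 addr0 mulr0 sin0 subr0 invf_div [x * _]mulrC.
Qed.

(** The bound does not depend on n, so that exponential moments can dominate all
    the Taylor sums of the sine at once. *)
Lemma norm_series_sin_le (x : R) n : `|series (sin_coeff x) n| <= expR `|x|.
Proof.
apply: (@le_trans _ _ (series (exp_coeff `|x|) n)).
  rewrite /series/=; apply: le_trans (ler_norm_sum _ _ _) _.
  apply: ler_sum => k _; rewrite /sin_coeff /exp_coeff /= !normrM normfV.
  rewrite normr_nat !normrX normrN1 expr1n mulr1 normr_nat -mulrA.
  rewrite ler_piMl ?divr_ge0 ?exprn_ge0//.
  by case: odd.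
apply: nondecreasing_cvgn_le; last exact: is_cvg_series_exp_coeff.
apply/nondecreasing_seqP => k; rewrite seriesSr lerDl.
exact: exp_coeff_ge0.
Qed.

End polynomial_indicator.

(** * Bounded multipliers of the L2 closure *)

Section multipliers.
Local Open Scope ereal_scope.
Context {R : realType} {d : measure_display} {T : measurableType d}.
Variable Pr : probability T R.
Implicit Types (f g h p : T -> R) (V : set (T -> R)).

(** It is enough to test the product on V: a multiplier then maps the whole
    closure of V into itself, which is what makes products of multipliers
    multipliers again. *)
Definition multiplier V : set (T -> R) :=
  [set h : T -> R | [/\ measurable_fun setT h,
               exists M : R, forall w, (`|h w| <= M)%R &
               forall p, V p -> L2closure Pr V (h \* p)%R]].

Variable V : set (T -> R).
Hypothesis V_L2 : forall p, V p -> p \in Lfun Pr 2%:E.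
Hypothesis V_cst : forall c, V (cst c).
Hypothesis V_add : forall p q, V p -> V q -> V (p \+ q)%R.
Hypothesis V_mul : forall p q, V p -> V q -> V (p \* q)%R.

Let V_scale c p : V p -> V (c \o* p)%R.
Proof. by move=> Vp; exact: (V_mul Vp (V_cst c)). Qed.

(** Multiplication by a function bounded by M multiplies [sqdist] by at most M^2,
    so an approximation p of g gives the approximation h p of h g. *)
Lemma multiplier_L2closure h g :
  multiplier V h -> L2closure Pr V g -> L2closure Pr V (h \* g)%R.
Proof.
move=> [mh [M hM] hV] [mg gV].
apply: (L2closure_approx V_L2); first exact: measurable_funM.
move=> e e0; have e'0 : (0 < e / (M ^+ 2 + 1))%R.
  by rewrite divr_gt0// ltr_wpDl// sqr_ge0.
have [p Vp gp] := gV _ e'0; exists (h \* p)%R; first exact: hV.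
have mp : measurable_fun setT p by exact: Lfun2_measurable (V_L2 Vp).
apply: (@le_lt_trans _ _ ((M ^+ 2)%:E * sqdist Pr g p)).
  rewrite /sqdist -ge0_integralZl//; last 3 first.
  - apply/measurable_EFinP; apply: measurable_funX; exact: measurable_funB.
  - by move=> w _; rewrite lee_fin sqr_ge0.
  - by rewrite lee_fin sqr_ge0.
  apply: ge0_le_integral => //.
  - by move=> w _; rewrite lee_fin sqr_ge0.
  - by apply/measurable_EFinP; apply: measurable_funX; apply: measurable_funB;
      exact: measurable_funM.
  - apply: measurable_funeM; apply/measurable_EFinP; apply: measurable_funX.
    exact: measurable_funB.
  move=> w _; rewrite -EFinM lee_fin /= -mulrBr exprMn ler_wpM2r ?sqr_ge0//.
  by rewrite -(real_normK (num_real (h w))) lerXn2r// nnegrE ?normr_ge0//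
    (le_trans _ (hM w)).
apply: (@le_lt_trans _ _ ((M ^+ 2)%:E * (e / (M ^+ 2 + 1))%:E)).
  by rewrite lee_wpmul2l ?lee_fin ?sqr_ge0// ltW.
rewrite -EFinM lte_fin mulrCA gtr_pMr// ltr_pdivrMr ?mul1r ?ltrDl//.
by rewrite ltr_wpDl// sqr_ge0.
Qed.

Lemma multiplier_cst c : multiplier V (cst c).
Proof.
split; first exact: measurable_cst.
  by exists `|c|%R.
by move=> p Vp; apply: (sub_L2closure V_L2); exact: V_mul.
Qed.

Lemma multiplierM h k : multiplier V h -> multiplier V k ->
  multiplier V (h \* k)%R.
Proof.
move=> Vh [mk [L kL] kV]; have [mh [M hM] hV] := Vh.
split; first exact: measurable_funM.
  by exists (M * L)%R => w; rewrite /= normrM ler_pM.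
move=> p Vp; rewrite (_ : _ \* p = h \* (k \* p))%R; last first.
  by apply/funext => w /=; rewrite mulrA.
by apply: multiplier_L2closure => //; exact: kV.
Qed.

Lemma multiplierD h k : multiplier V h -> multiplier V k ->
  multiplier V (h \+ k)%R.
Proof.
move=> [mh [M hM] hV] [mk [L kL] kV].
split; first exact: measurable_funD.
  by exists (M + L)%R => w; rewrite /= (le_trans (ler_normD _ _))// lerD.
move=> p Vp; rewrite (_ : _ \* p = (h \* p) \+ (k \* p))%R; last first.
  by apply/funext => w /=; rewrite mulrDl.
by apply: (L2closureD V_L2) => //; [exact: hV|exact: kV].
Qed.

Lemma multiplier_onem h : multiplier V h -> multiplier V (fun w => 1 - h w)%R.
Proof.
move=> Vh; rewrite (_ : (fun w => _) = cst 1 \+ (cst (-1) \* h))%R; last first.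
  by apply/funext => w /=; rewrite mulN1r.
apply: multiplierD; first exact: multiplier_cst.
by apply: multiplierM => //; exact: multiplier_cst.
Qed.

Lemma multiplierX h n : multiplier V h -> multiplier V (fun w => h w ^+ n)%R.
Proof.
move=> Vh; elim: n => [|n IH]; first exact: (multiplier_cst 1).
rewrite (_ : (fun w => _) = h \* (fun w => h w ^+ n))%R; last first.
  by apply/funext => w /=; rewrite exprS.
exact: multiplierM.
Qed.

(** The products with p converge under the domination M |p|. *)
Lemma multiplier_cvg (h_ : nat -> T -> R) h M :
  (forall n, multiplier V (h_ n)) -> (forall n w, `|h_ n w| <= M)%R ->
  (forall w, h_ n w @[n --> \oo] --> h w) -> multiplier V h.
Proof.
move=> Vh hM hh; split.
- apply: (measurable_fun_cvg (h := h_)); first by move=> n; have [] := Vh n.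
  by move=> w _; exact: hh.
- exists M => w; have cg : `|h_ n w|%R @[n --> \oo] --> `|h w|%R.
    by apply: cvg_norm; exact: hh.
  rewrite -(cvg_lim _ cg)//; apply: limr_le.
    by apply/cvg_ex; exists `|h w|%R.
  by apply: nearW => n; exact: hM.
move=> p Vp.
apply: (@L2closure_cvg _ _ _ _ _ V_L2 (fun n => h_ n \* p)%R _
  (fun w => `|M * p w|)%R).
- by move=> n; have [_ _] := Vh n; exact.
- by move=> w; apply: cvgM; [exact: hh|exact: cvg_cst].
- have /Lfun2P[mp p2] := V_L2 (V_scale M Vp); apply/Lfun2P; split.
    by apply: measurableT_comp => //; move: mp; under eq_fun do rewrite /= mulrC.
  apply: le_lt_trans p2; rewrite le_eqVlt; apply/orP; left; apply/eqP.
  by apply: eq_integral => w _; rewrite real_normK ?num_real//= mulrC.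
- move=> n w /=; rewrite !normrM ler_wpM2r//.
  by apply: le_trans (hM n w) (ler_norm _).
Qed.

Definition multiplier_event : set (set T) := [set B | multiplier V (\1_B)].

Let eventI B C : multiplier_event B -> multiplier_event C ->
  multiplier_event (B `&` C).
Proof.
by move=> VB VC; rewrite /multiplier_event /= indicI; exact: multiplierM.
Qed.

Let eventC B : multiplier_event B -> multiplier_event (~` B).
Proof.
move=> /multiplier_onem; rewrite /multiplier_event /= indicC.
rewrite (_ : (fun w => _) = (fun w => (w \notin B)%:R))//.
by apply/funext => w; rewrite indicE; case: (_ \in _); rewrite ?subrr ?subr0.
Qed.

(** Complements and intersections correspond to 1 - h and to products; a
    countable union is the bounded limit of its finite unions. *)
Lemma sigma_algebra_multiplier_event : sigma_algebra setT multiplier_event.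
Proof.
have event0 : multiplier_event set0.
  by rewrite /multiplier_event /= indic0; exact: multiplier_cst.
split => //.
- by move=> B; rewrite setTD; exact: eventC.
move=> F VF.
apply: (@multiplier_cvg (fun n => \1_(\big[setU/set0]_(k < n) F k)) _ 1%R).
- move=> n; elim/big_ind : _ => [//|B C VB VC|k _]; last exact: VF.
  rewrite -[_ `|` _]setCK setCU; apply: (eventC (eventI _ _)); exact: eventC.
- by move=> n w; rewrite indicE; case: (_ \in _); rewrite ?normr1 ?normr0.
- move=> w; rewrite [X in _ --> X]indicE; apply: cvg_near_cst.
  have [[k _ Fkw]|nF] := pselect ((\bigcup_k F k) w).
    have -> : w \in \bigcup_k F k by apply/mem_set; exists k.
    exists k.+1 => // n /= kn; rewrite indicE.
    suff -> : w \in \big[setU/set0]_(k < n) F k by [].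
    by apply/mem_set; rewrite -bigcup_mkord; exists k.
  rewrite memNset//; apply: nearW => n; rewrite indicE memNset//.
  by rewrite -bigcup_mkord => -[k _ Fkw]; apply: nF; exists k.
Qed.

(** An affine change of variable turns h into u with values in [0, 1] and a < h
    into u < 1/2; the polynomials of [cvg_polynomial_indicator] in u are
    multipliers and converge to the indicator of the event. *)
Lemma multiplier_event_gt h a : multiplier V h ->
  multiplier_event [set w | a < h w]%R.
Proof.
move=> Vh; have [_ [M hM] _] := Vh.
pose C := (`|M| + `|a| + 1)%R.
have C0 : (0 < C)%R by rewrite ltr_wpDl// addr_ge0.
have hC w : (`|h w - a| <= C)%R.
  rewrite (le_trans (ler_normB _ _))// /C.
  by have := hM w; have := ler_norm M; lra.
pose u w : R := (1 / 2 - (2 * C)^-1 * (h w - a))%R.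
have uE w : (u w = (C - (h w - a)) / (2 * C))%R.
  by rewrite /u; field; rewrite gt_eqF.
have Vu : multiplier V u.
  rewrite (_ : u = (cst (1 / 2 + (2 * C)^-1 * a) \+ (cst (- (2 * C)^-1) \* h))%R).
    apply: multiplierD; first exact: multiplier_cst.
    by apply: multiplierM => //; exact: multiplier_cst.
  by apply/funext => w /=; rewrite /u; ring.
have u01 w : (0 <= u w <= 1)%R.
  have := hC w; rewrite ler_norml => /andP[? ?].
  rewrite uE divr_ge0 ?mulr_ge0//; last 2 first.
  - lra.
  - exact: ltW.
  by rewrite ler_pdivrMr ?mulr_gt0// mul1r; lra.
have u12 w : (u w < 1 / 2)%R = (a < h w)%R.
  by rewrite /u gtrBl pmulr_rgt0 ?subr_gt0// invr_gt0 mulr_gt0.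
apply: (@multiplier_cvg (fun n w => (1 - u w ^+ n) ^+ (n * 2 ^ n))%R _ 1%R).
- by move=> n; apply/multiplierX/multiplier_onem/multiplierX.
- move=> n w; have /andP[? ?] := u01 w.
  have ? : (0 <= 1 - u w ^+ n)%R by rewrite subr_ge0 exprn_ile1.
  by rewrite ger0_norm ?exprn_ge0// exprn_ile1// gerBl exprn_ge0.
- move=> w; rewrite [X in _ --> X]indicE.
  rewrite (_ : (w \in _) = (u w < 1 / 2)%R); last first.
    by rewrite u12; apply/idP/idP; rewrite inE.
  exact: cvg_polynomial_indicator.
Qed.

End multipliers.

(** * Density under exponential integrability *)

Section density_in_L2.
Local Open Scope ereal_scope.
Context {R : realType} {d : measure_display} {T : measurableType d}.
Variable Pr : probability T R.
Implicit Types (f g h p : T -> R).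
Variable V : set (T -> R).
Hypothesis V_L2 : forall p, V p -> p \in Lfun Pr 2%:E.
Hypothesis V_cst : forall c, V (cst c).
Hypothesis V_add : forall p q, V p -> V q -> V (p \+ q)%R.
Hypothesis V_mul : forall p q, V p -> V q -> V (p \* q)%R.

Let V_exp p n : V p -> V (fun w => p w ^+ n)%R.
Proof.
move=> Vp; elim: n => [|n IH]; first exact: (V_cst 1).
rewrite (_ : (fun w => _) = p \* (fun w => p w ^+ n))%R; first exact: V_mul.
by apply/funext => w; rewrite exprS.
Qed.

(** The Taylor sums of sin (t X), times p, belong to V and are dominated by
    exp |t X| |p|; the square of this bound is at most exp (4 |t X|) + p^4,
    where p^4 is integrable because V is stable under products. *)
Lemma multiplier_sin X t : V X ->
  \int[Pr]_w (expR (4 * `|t * X w|))%:E < +oo ->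
  multiplier Pr V (fun w => sin (t * X w)).
Proof.
move=> VX Xexp; have mX := Lfun2_measurable (V_L2 VX).
have msin : measurable_fun setT (fun w => sin (t * X w)).
  apply: measurableT_comp; last exact: measurable_funM.
  by apply: continuous_measurable_fun; exact: continuous_sin.
split => //.
  by exists 1%R => w; rewrite ler_norml sin_geN1 sin_le1.
move=> p Vp; have mp := Lfun2_measurable (V_L2 Vp).
have mE c : measurable_fun setT (fun w => expR (c * `|t * X w|))%R.
  apply: measurableT_comp => //; apply: measurable_funM => //.
  by apply: measurableT_comp => //; exact: measurable_funM.
apply: (@L2closure_cvg _ _ _ _ _ V_L2
  (fun n w => series (sin_coeff (t * X w)) n * p w)%R _
  (fun w => expR (1 * `|t * X w|) * `|p w|)%R).
- move=> n; apply: (sub_L2closure V_L2).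
  elim: n => [|n IH].
    rewrite (_ : (fun w => _) = cst 0)%R; first exact: V_cst.
    by apply/funext => w; rewrite /series/= big_geq// mul0r.
  pose c := ((odd n)%:R * (-1) ^+ n.-1./2 / n`!%:R * t ^+ n : R)%R.
  rewrite (_ : (fun w => _) = (fun w => series (sin_coeff (t * X w)) n * p w) \+
      (cst c \* ((fun w => X w ^+ n) \* p)))%R.
    by apply: V_add => //; apply: V_mul => //; apply: V_mul => //; exact: V_exp.
  apply/funext => w; rewrite seriesSr mulrDl /= sin_coeffE; congr (_ + _)%R.
  by rewrite /c exprMn !mulrA.
- move=> w; apply: cvgM; last exact: cvg_cst.
  by rewrite unlock; exact: is_cvg_series_sin_coeff.
- apply/Lfun2P; split.
    by apply: measurable_funM => //; exact: measurableT_comp.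
  have /Lfun2P[_ p4] := V_L2 (V_exp 2 Vp).
  apply: (@le_lt_trans _ _ (\int[Pr]_w ((expR (4 * `|t * X w|))%:E +
     (((p w ^+ 2) ^+ 2)%R)%:E))).
    apply: ge0_le_integral => //.
    + apply/measurable_EFinP; apply: measurable_funX; apply: measurable_funM => //.
      exact: measurableT_comp.
    + apply: emeasurable_funD; apply/measurable_EFinP => //.
      by apply: measurable_funX; exact: measurable_funX.
    move=> w _; rewrite -EFinD lee_fin mul1r exprMn real_normK ?num_real//.
    rewrite mulrC expRM_natl (_ : 4 = 2 * 2)%N// exprM.
    set a := (expR _ ^+ 2)%R; set b := (p w ^+ 2)%R.
    have a0 : (0 <= a)%R by rewrite sqr_ge0.
    have b0 : (0 <= b)%R by rewrite sqr_ge0.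
    have := sqr_ge0 (a - b)%R; have := sqr_ge0 a; have := sqr_ge0 b; lra.
  rewrite ge0_integralD//.
  + by apply: lte_add_pinfty.
  + exact/measurable_EFinP.
  + by move=> w _; rewrite lee_fin sqr_ge0.
  + by apply/measurable_EFinP; apply: measurable_funX; exact: measurable_funX.
- move=> n w; rewrite normrM mul1r ler_wpM2r//.
  exact: norm_series_sin_le.
Qed.

(** [T] with the events whose indicator is a multiplier. *)
Let S := g_sigma_algebraType (multiplier_event Pr V).

Let measurable_S (B : set S) : measurable B <-> multiplier_event Pr V B.
Proof.
rewrite -[X in X B <-> _]/(<<s multiplier_event Pr V >>) sigma_algebra_id//.
exact: sigma_algebra_multiplier_event.
Qed.

Let measurable_multiplier h : multiplier Pr V h ->
  measurable_fun [set: S] (h : S -> R).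
Proof.
move=> Vh mD; apply: (measurability _ (RGenOInfty.measurableE R)) => //.
move=> _ [_ [a ->] <-]; rewrite setTI; apply/measurable_S.
rewrite (_ : _ @^-1` _ = [set w | a < h w]%R); first exact: multiplier_event_gt.
by apply/seteqP; split => w /=; rewrite in_itv/= andbT.
Qed.

Import HBNNSimple.

(** Simple functions for [S] are combinations of multipliers, hence in the
    closure, and they approximate g from below. *)
Let ge0_L2closure g : (forall w, 0 <= g w)%R -> g \in Lfun Pr 2%:E ->
  measurable_fun [set: S] (g : S -> R) -> L2closure Pr V g.
Proof.
move=> g0 g2 mg.
have mg' : measurable_fun [set: S] (EFin \o (g : S -> R)).
  exact/measurable_EFinP.
pose h := nnsfun_approx measurableT mg'.
have hg w : (h n w)%:E @[n --> \oo] --> (g w)%:E.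
  by apply: (cvg_nnsfun_approx measurableT mg') => // z _; rewrite lee_fin.
apply: (@L2closure_cvg _ _ _ _ _ V_L2 (fun n => h n : T -> R) _ g) => //.
- move=> n; rewrite (_ : (h n : T -> R) = fun w =>
    \sum_(r <- finmap.enum_fset (fset_set (range (h n))))
      (r * \1_(h n @^-1` [set r]) w))%R; last first.
    by apply/funext => w; rewrite fimfunE fsbig_finite.
  elim: (finmap.enum_fset _) => [|r s IH].
    rewrite (_ : (fun w => _) = cst 0%R); first exact: (sub_L2closure V_L2).
    by apply/funext => w; rewrite big_nil.
  rewrite (_ : (fun w => _) = (r \o* (\1_(h n @^-1` [set r]) \* cst 1) \+
      fun w => \sum_(r <- s) (r * \1_(h n @^-1` [set r]) w))%R); last first.
    by apply/funext => w /=; rewrite big_cons mulr1 mulrC.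
  apply: (L2closureD V_L2) => //; apply: (L2closureZ V_L2).
    by move=> b p Vp; exact: (V_mul Vp (V_cst b)).
  have [_ _] : multiplier Pr V \1_(h n @^-1` [set r]).
    apply/(measurable_S (h n @^-1` [set r])); 
    by rewrite -[X in measurable X]setTI; exact: measurable_funP.
  by apply; exact: V_cst.
- move=> w; have /fine_cvgP[_] := hg w; exact.
- move=> n w; rewrite ger0_norm// -lee_fin.
  rewrite /h nnsfun_approxE; apply: (le_approx (f := EFin \o g)) => // z _.
  by rewrite lee_fin.
Qed.

(** Each X_i is a limit of multiples of sin (s X_i) with s small, hence measurable
    for [S]; so are X and y o X, and square integrable functions that are
    measurable for [S] belong to the closure. *)
Theorem L2closure_full n (X : T -> 'rV[R]_n) (A : set 'rV[R]_n)
    (y : 'rV[R]_n -> R) :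
  (forall i, V (fun w => X w ord0 i)) ->
  (forall i, exists2 t : R, (0 < t)%R &
    \int[Pr]_w (expR (t * `|X w ord0 i|))%:E < +oo) ->
  measurable A -> (forall w, A (X w)) -> measurable_fun A y ->
  y \o X \in Lfun Pr 2%:E -> L2closure Pr V (y \o X).
Proof.
move=> VX Xexp mA AX my yL2.
have mX : measurable_fun [set: S] (X : S -> 'rV[R]_n).
  apply: measurable_fun_rV => i; have [t t0 tX] := Xexp i.
  have mXi := Lfun2_measurable (V_L2 (VX i)).
  (* [multiplier_sin] needs the exponential moment at four times its parameter. *)
  pose s := (t / 4)%R; have s0 : (0 < s)%R by rewrite divr_gt0.
  apply: (@measurable_fun_cvg _ S R setT
    (fun k (w : S) => (k.+1%:R / s * sin (s / k.+1%:R * X w ord0 i))%R)); last first.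
    by move=> w _; apply: cvg_sin_div; rewrite gt_eqF.
  move=> k; apply: measurable_funM => //; apply: measurable_multiplier.
  apply: multiplier_sin => //; apply: le_lt_trans tX.
  have m c : measurable_fun setT (fun w => (expR (c * `|X w ord0 i|))%:E).
    apply/measurable_EFinP; apply: measurableT_comp => //.
    by apply: measurable_funM => //; exact: measurableT_comp.
  apply: ge0_le_integral => //.
  - under eq_fun do rewrite normrM mulrA; exact: m.
  move=> w _; rewrite lee_fin ler_expR normrM mulrA ler_wpM2r//.
  rewrite gtr0_norm ?divr_gt0// /s; 
  rewrite [leRHS](_ : _ = 4 * (t / 4))%R; last by field.
  by rewrite ler_pM2l// ler_pdivrMr// ler_peMr ?ler1n//; apply/ltW.
have mZ : measurable_fun [set: S] ((y \o X) : S -> R).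
  by apply: (measurable_comp mA) => // _ [w _ <-].
have [mZT ZL2] := (Lfun2P _ _).1 yL2.
pose Zp w := Num.max (y (X w)) 0%R; pose Zn w := Num.max (- y (X w))%R 0%R.
rewrite (_ : y \o X = (Zp \+ (-1 \o* Zn))%R); last first.
  apply/funext => w; rewrite /Zp /Zn /=.
  by have [?|?] := lerP (y (X w)) 0; have [?|?] := lerP (- y (X w)) 0; lra.
have Z2 (Z : T -> R) : measurable_fun setT Z ->
    (forall w, `|Z w| <= `|y (X w)|)%R ->
    Z \in Lfun Pr 2%:E.
  move=> mZ' Zy; apply/Lfun2P; split=> //; apply: le_lt_trans ZL2.
  apply: ge0_le_integral => //.
  - by move=> w _; rewrite lee_fin sqr_ge0.
  - by apply/measurable_EFinP; exact: measurable_funX.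
  - by apply/measurable_EFinP; exact: measurable_funX.
  move=> w _; rewrite lee_fin -(real_normK (num_real (Z w))).
  by rewrite -(real_normK (num_real ((y \o X) w))) lerXn2r ?nnegrE.
have mZN : measurable_fun setT (fun w => - y (X w))%R by exact: measurable_funN.
apply: (L2closureD V_L2) => //; last apply: (L2closureZ V_L2).
- apply: ge0_L2closure.
  + by move=> w; rewrite le_max lexx orbT.
  + apply: Z2 => [|w]; first exact: (measurable_maxr mZT (measurable_cst _)).
    by rewrite /Zp; have [?|?] := lerP (y (X w)) 0; rewrite ?normr0.
  + exact: (measurable_maxr mZ (measurable_cst _)).
- by move=> b p Vp; exact: (V_mul Vp (V_cst b)).
- apply: ge0_L2closure.
  + by move=> w; rewrite le_max lexx orbT.
  + apply: Z2 => [|w]; first exact: (measurable_maxr mZN (measurable_cst _)).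
    by rewrite /Zn; have [?|?] := lerP (- y (X w)) 0; rewrite ?normr0 ?normrN.
  + exact: (measurable_maxr (measurable_funN mZ) (measurable_cst _)).
Qed.

End density_in_L2.

(** * Comparison of norms *)

Section norm_comparison.
Context {R : realType} {n : nat}.
Implicit Types (x z : 'rV[R]_n) (nrm : 'rV[R]_n -> R).

Lemma coord_le_norm x i : `|x ord0 i| <= `|x|.
Proof.
rewrite (mx_normrE x : `|x| = _).
exact: (le_bigmax _ (fun ij : 'I_1 * 'I_n => `|x ij.1 ij.2|) (ord0, i)).
Qed.

(** The triangle inequality and the expansion in the canonical basis make a norm
    Lipschitz for the supremum norm. *)
Lemma continuous_is_norm nrm : is_norm nrm -> continuous nrm.
Proof.
move=> [nrm0 nrmZ nrmD].
pose C := \sum_(i < n) nrm (delta_mx 0 i).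
have nrm00 : nrm 0 = 0 by rewrite -(scale0r 0) nrmZ normr0 mul0r.
have nrmN x : nrm (- x) = nrm x by rewrite -scaleN1r nrmZ normrN1 mul1r.
have nrm_ge0 x : 0 <= nrm x.
  by have := nrmD x (- x); rewrite subrr nrm00 nrmN; lra.
have nrm_le x : nrm x <= C * `|x|.
  rewrite {1}(row_sum_delta x) mulr_suml.
  have : nrm (\sum_(j < n) x 0 j *: delta_mx 0 j) <=
      \sum_(j < n) nrm (x 0 j *: delta_mx 0 j).
    elim/big_rec2 : _ => [|j a b _ ab]; first by rewrite nrm00.
    by apply: le_trans (nrmD _ _) _; rewrite lerD2l.
  move=> /le_trans; apply; apply: ler_sum => j _.
  by rewrite nrmZ mulrC ler_wpM2l// coord_le_norm.
have C0 : 0 <= C by apply: sumr_ge0.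
(* C vanishes when n = 0, whereas the Lipschitz constant is divided by below. *)
have nrmB x z : `|nrm x - nrm z| <= (C + 1) * `|x - z|.
  apply: (@le_trans _ _ (C * `|x - z|)); last by rewrite ler_wpM2r// lerDl.
  apply: le_trans (nrm_le _); rewrite ler_norml.
  have := nrmD (x - z) z; rewrite subrK.
  have := nrmD (- (x - z)) x; rewrite nrmN opprB subrK; lra.
move=> x; apply/(@cvgrPdist_lt _ R^o _ _ (nbhs_filter x)) => e e0.
have C1 : 0 < C + 1 by rewrite ltr_wpDl.
apply/nbhs_ballP; exists (e / (C + 1)) => /=; first exact: divr_gt0.
move=> z; rewrite mx_norm_ball /ball_/= => xz.
by apply: le_lt_trans (nrmB _ _) _; rewrite mulrC -ltr_pdivlMr.
Qed.

(** The constant is the minimum of the norm on the compact unit sphere of the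
    supremum norm. *)
Lemma coord_le_is_norm nrm : is_norm nrm ->
  exists2 c : R, 0 < c & forall x i, c * `|x ord0 i| <= nrm x.
Proof.
move=> nrmP; have [nrm0 nrmZ nrmD] := nrmP.
have cnrm := continuous_is_norm nrmP.
have nrm00 : nrm 0 = 0 by rewrite -(scale0r 0) nrmZ normr0 mul0r.
have nrm_ge0 x : 0 <= nrm x.
  have := nrmD x (- x); rewrite subrr nrm00 -scaleN1r nrmZ normrN1 mul1r; lra.
pose sphere := [set x : 'rV[R]_n | `|x| = 1].
have x0 x : x != 0 -> sphere (`|x|^-1 *: x).
  by move=> xn0; rewrite /sphere/= mx_normZ normfV normr_id mulVf// normr_eq0.
suff [c c0 cP] : exists2 c : R, 0 < c & forall x, sphere x -> c <= nrm x.
  exists c => // x i; have [->|xn0] := eqVneq x 0.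
    by rewrite mxE normr0 mulr0.
  apply: (@le_trans _ _ (c * `|x|)); first by rewrite ler_pM2l// coord_le_norm.
  have := cP _ (x0 _ xn0); rewrite nrmZ normfV normr_id mulrC.
  by rewrite ler_pdivlMr// normr_gt0.
have [[x sx]|nsphere] := pselect (exists x, sphere x); last first.
  by exists 1 => // x sx; case: nsphere; exists x.
have csphere : compact sphere.
  apply: bounded_closed_compact.
    exists 1; split; first exact: num_real.
    by move=> M M1 z sz; move: M1; rewrite /= -(sz : `|z| = 1) => /ltW.
  rewrite (_ : sphere = (fun x => `|x|) @^-1` [set 1 : R])//.
  apply: closed_comp; last exact: closed_eq.
  by move=> z _; exact: norm_continuous.
have [|c /set_mem sc cmin] := EVT_min_rV _ csphere (continuous_subspaceT cnrm).
  by exists x.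
exists (nrm c).
  rewrite lt_def nrm_ge0 andbT; apply/eqP => /nrm0 c0.
  by move: sc; rewrite /sphere/= c0 normr0 => /esym/eqP; rewrite oner_eq0.
by move=> z sz; apply: cmin; exact: mem_set.
Qed.

End norm_comparison.

(** * Integration against a density *)

Section measure_with_density.
Local Open Scope ereal_scope.
Context {R : realType} {d : measure_display} {T : measurableType d}.
Variables (mu nu : {measure set T -> \bar R}) (A : set T) (f : T -> R).
Hypothesis mA : measurable A.
Hypothesis mf : measurable_fun A f.
Hypothesis f_ge0 : forall x, A x -> (0 <= f x)%R.
Hypothesis nuE : forall B, measurable B ->
  nu B = \int[mu]_(x in A `&` B) (f x)%:E.

Import HBNNSimple.

(** By linearity this reduces to the definition of nu on the level sets of h. *)
Let integral_density_nnsfun (h : {nnsfun T >-> R}) :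
  \int[nu]_x (h x)%:E = \int[mu]_(x in A) (h x * f x)%:E.
Proof.
pose s := finmap.enum_fset (fset_set (range h)).
have hE x : h x = (\sum_(r <- s) r * \1_(h @^-1` [set r]) x)%R.
  by rewrite fimfunE fsbig_finite.
have h_ge0 r x : (0 <= r * \1_(h @^-1` [set r]) x)%R.
  rewrite indicE; have [|_] := boolP (x \in _); last by rewrite mulr0.
  by rewrite inE /= => <-; rewrite mulr1.
have mh r : measurable (h @^-1` [set r]).
  by rewrite -[X in measurable X]setTI; exact: measurable_funP.
under eq_integral do rewrite hE -sumEFin.
under [RHS]eq_integral do rewrite hE mulr_suml -sumEFin.
rewrite !ge0_integral_sum//; last 4 first.
- move=> r; apply/measurable_EFinP; apply: measurable_funM => //.
  by apply: measurable_funM => //; exact: measurable_indic.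
- by move=> r x Ax; rewrite lee_fin mulr_ge0// f_ge0.
- move=> r; apply/measurable_EFinP.
  by apply: measurable_funM => //; exact: measurable_indic.
- by move=> r x _; rewrite lee_fin.
apply: eq_bigr => r _.
have [r0|r0] := leP 0%R r; last first.
  have h0 x : (\1_(h @^-1` [set r]) x = 0 :> R)%R.
    rewrite indicE memNset//= => hx.
    by move: r0; rewrite -hx ltNge fun_ge0.
  under eq_integral do rewrite h0 mulr0.
  under [RHS]eq_integral do rewrite h0 mulr0 mul0r.
  by rewrite !integral0.
under eq_integral do rewrite EFinM.
under [RHS]eq_integral do rewrite -mulrA EFinM.
rewrite ge0_integralZl//; last exact/measurable_EFinP/measurable_indic.
rewrite ge0_integralZl//; last 2 first.
- apply/measurable_EFinP; apply: measurable_funM => //; exact: measurable_indic.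
- by move=> x Ax; rewrite lee_fin mulr_ge0// f_ge0.
rewrite integral_indic// setIT nuE//; congr (_ * _).
rewrite integral_mkcondr; apply: eq_integral => x _.
by rewrite patchE indicE; case: (x \in _); rewrite ?mul1r ?mul0r.
Qed.

Lemma ge0_integral_density (g : T -> R) : measurable_fun setT g ->
  (forall x, 0 <= g x)%R ->
  \int[nu]_x (g x)%:E = \int[mu]_(x in A) (g x * f x)%:E.
Proof.
move=> mg g0.
have mg' : measurable_fun setT (EFin \o g) by exact/measurable_EFinP.
pose h := nnsfun_approx measurableT mg'.
have hg x : (h n x)%:E @[n --> \oo] --> (g x)%:E.
  by apply: (cvg_nnsfun_approx measurableT mg') => // z _; rewrite lee_fin.
have hgf x : (h n x * f x)%:E @[n --> \oo] --> (g x * f x)%:E.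
  have /fine_cvgP[_ hgx] := hg x.
  apply: cvg_EFin; first exact: nearW.
  by apply: cvgM; [exact: hgx|exact: cvg_cst].
have nd x : {homo (fun n => h n x) : n m / (n <= m)%N >-> (n <= m)%R}.
  by move=> n m nm; exact/lefP/nd_nnsfun_approx.
transitivity (lim (\int[nu]_x (h n x)%:E @[n --> \oo])).
  rewrite -monotone_convergence//.
  - by apply: eq_integral => x _; apply/esym/cvg_lim.
  - by move=> n; exact/measurable_EFinP.
  - by move=> n x _; rewrite lee_fin.
  - by move=> x _ n m nm; rewrite lee_fin nd.
transitivity (lim (\int[mu]_(x in A) (h n x * f x)%:E @[n --> \oo])).
  by under eq_fun do rewrite integral_density_nnsfun.
rewrite -monotone_convergence//.
- by apply: eq_integral => x _; apply/cvg_lim => //; exact: hgf.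
- move=> n; apply/measurable_EFinP; apply: measurable_funM => //.
  exact: measurable_funTS.
- by move=> n x Ax; rewrite lee_fin mulr_ge0// f_ge0.
- by move=> x Ax n m nm; rewrite lee_fin ler_wpM2r ?f_ge0// nd.
Qed.

End measure_with_density.

(** * Polynomials in an admissible input *)

Section measurable_rV.
Context {R : realType} {n : nat}.

Lemma within_continuous_measurable_fun (A : set 'rV[R]_n) (f : 'rV[R]_n -> R) :
  measurable A -> {within A, continuous f} -> measurable_fun A f.
Proof.
move=> mA cf; apply: (measurability _ (RGenOpens.measurableE R)).
move=> _ [_ [a [b ->]] <-].
have /open_subspaceP[U oU UA] : open (f @^-1` `]a, b[%classic : set (subspace A)).
  by move/continuousP : cf; apply; exact: interval_open.
rewrite setIC -UA; apply: measurableI => //.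
exact: open_measurable_rV.
Qed.

Lemma continuous_rV_measurable_fun (f : 'rV[R]_n -> R) :
  continuous f -> measurable_fun setT f.
Proof.
by move=> cf; apply: within_continuous_measurable_fun => //;
  exact: continuous_subspaceT.
Qed.

End measurable_rV.

Section monomials.
Context {R : realType} {N : nat}.
Implicit Types (x : 'rV[R]_N) (j k : multi_index N).

Lemma measurable_monomial j : measurable_fun setT (@monomial R N j).
Proof.
apply: measurable_prod => i _; apply: measurable_funX.
exact: measurable_coord.
Qed.

Lemma monomial0 x : monomial (0 : multi_index N) x = 1.
Proof. by rewrite /monomial big1// => i _; rewrite ffunE expr0. Qed.

Lemma monomialD j k x : monomial (j + k) x = monomial j x * monomial k x.
Proof.
by rewrite /monomial -big_split; apply: eq_bigr => i _; rewrite ffunE exprD.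
Qed.

Definition coord_index (i : 'I_N) : multi_index N := [ffun k => (k == i) : nat].

Lemma monomial_coord i x : monomial (coord_index i) x = x ord0 i.
Proof.
rewrite /monomial (bigD1 i)//= big1 ?mulr1; last first.
  by move=> k /negbTE ki; rewrite ffunE ki expr0.
by rewrite ffunE eqxx expr1.
Qed.

(** A multi-index may occur several times in s, so that sums and products of
    polynomials are concatenations and pairwise products of terms. *)
Definition polynomial_of (s : seq (R * multi_index N)) x : R :=
  \sum_(c <- s) c.1 * monomial c.2 x.

Lemma measurable_polynomial_of s : measurable_fun setT (polynomial_of s).
Proof.
apply: measurable_sum => c; apply: measurable_funM => //.
exact: measurable_monomial.
Qed.

End monomials.

Section admissible_input_theory.
Local Open Scope ereal_scope.
Context {R : realType} {d : measure_display} {T : measurableType d}.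
Context {Pr : probability T R} {N : nat} {X : {RV Pr >-> 'rV[R]_N}}.
Context {A : set 'rV[R]_N} {f : 'rV[R]_N -> R}.
Hypothesis hX : admissible_input X A f.
Implicit Types g : 'rV[R]_N -> R.

Let mA : measurable A. Proof. by case: hX. Qed.
Let f_ge0 x : A x -> (0 <= f x)%R.
Proof. by move=> ?; apply: (density_ge0 hX). Qed.
Let mf : measurable_fun A f.
Proof.
by apply: within_continuous_measurable_fun => //; exact: (density_continuous hX).
Qed.

Lemma measurable_input : measurable_fun setT X.
Proof. exact: measurable_funP. Qed.

Lemma ge0_expectation_density g : measurable_fun setT g -> (forall x, 0 <= g x)%R ->
  \int[Pr]_w (g (X w))%:E = \int[lebesgue_rV R N]_(x in A) (g x * f x)%:E.
Proof.
move=> mg g0.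
rewrite -(@ge0_integral_density _ _ _ _ (distribution Pr X) A f)//;
  last exact: density_law hX.
rewrite ge0_integral_distribution//; exact/measurable_EFinP.
Qed.

(** Positive and negative parts are treated separately: as f is nonnegative on A,
    the parts of g f are the products of the parts of g with f. *)
Lemma expectation_density g : measurable_fun setT g ->
  \int[Pr]_w (g (X w))%:E = \int[lebesgue_rV R N]_(x in A) (g x * f x)%:E.
Proof.
move=> mg; rewrite integralE [RHS]integralE; congr (_ - _).
- transitivity (\int[Pr]_w (Num.max (g (X w)) 0)%:E).
    by apply: eq_integral => w _; rewrite funeposE -EFin_max.
  rewrite (ge0_expectation_density (g := fun x => Num.max (g x) 0)%R).
  + apply: eq_integral => x /set_mem Ax; rewrite funeposE -EFin_max.
    by rewrite maxr_pMl ?f_ge0// mul0r.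
  + exact: (measurable_maxr mg (measurable_cst _)).
  + by move=> x; rewrite le_max lexx orbT.
- transitivity (\int[Pr]_w (Num.max (- g (X w)) 0)%:E).
    by apply: eq_integral => w _; rewrite funenegE -EFinN -EFin_max.
  rewrite (ge0_expectation_density (g := fun x => Num.max (- g x) 0)%R).
  + apply: eq_integral => x /set_mem Ax; rewrite funenegE -EFinN -EFin_max.
    by rewrite maxr_pMl ?f_ge0// mul0r mulNr.
  + exact: (measurable_maxr (measurable_funN mg) (measurable_cst _)).
  + by move=> x; rewrite le_max lexx orbT.
Qed.

Lemma integrable_monomial j : Pr.-integrable setT (fun w => (monomial j (X w))%:E).
Proof.
apply/integrableP; split.
  apply/measurable_EFinP; apply: (measurableT_comp (measurable_monomial j)).
  exact: measurable_input.
rewrite (ge0_expectation_density (g := fun x => `|monomial j x|%R))//.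
  exact: (finite_moments hX).
by apply: measurableT_comp => //; exact: measurable_monomial.
Qed.

Lemma integrable_polynomial s :
  Pr.-integrable setT (fun w => (polynomial_of s (X w))%:E).
Proof.
rewrite /polynomial_of; under eq_fun do rewrite -sumEFin.
apply: integrable_sum => // c _; under eq_fun do rewrite EFinM.
by apply: integrableZl => //; exact: integrable_monomial.
Qed.

Definition input_polynomials : set (T -> R) :=
  [set p | exists s, forall w, p w = polynomial_of s (X w)].

Lemma input_polynomials_cst c : input_polynomials (cst c).
Proof.
exists [:: (c, 0%R)] => w.
by rewrite /polynomial_of big_seq1 monomial0 mulr1.
Qed.

Lemma input_polynomialsD p q : input_polynomials p -> input_polynomials q ->
  input_polynomials (p \+ q)%R.
Proof.
move=> [s ps] [t qt]; exists (s ++ t) => w.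
by rewrite /polynomial_of big_cat/= ps qt.
Qed.

Lemma input_polynomialsM p q : input_polynomials p -> input_polynomials q ->
  input_polynomials (p \* q)%R.
Proof.
move=> [s ps] [t qt].
exists [seq ((a.1 * b.1)%R, (a.2 + b.2)%R) | a <- s, b <- t] => w.
rewrite /polynomial_of big_allpairs_dep/= ps qt mulr_suml; apply: eq_bigr => a _.
rewrite mulr_sumr; apply: eq_bigr => b _.
by rewrite monomialD mulrACA.
Qed.

Lemma input_polynomials_L2 p : input_polynomials p -> p \in Lfun Pr 2%:E.
Proof.
move=> Vp; have [s ps] := Vp; have [t pt] := input_polynomialsM Vp Vp.
apply/Lfun2P; split.
  rewrite (_ : p = polynomial_of s \o X); last by apply/funext.
  by apply: measurableT_comp; [exact: measurable_polynomial_of|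
    exact: measurable_input].
rewrite (eq_integral (fun w => (polynomial_of t (X w))%:E)).
  have := integrable_polynomial t.
  by move=> /(integrable_fin_num measurableT); rewrite fin_numE ltey => /andP[].
by move=> w _; rewrite expr2 -pt.
Qed.

(** In the compact case |X_i| is bounded almost surely; otherwise nrm dominates a
    multiple of |x_i|. *)
Lemma exp_moment i : exists2 t : R, (0 < t)%R &
  \int[Pr]_w (expR (t * `|X w ord0 i|))%:E < +oo.
Proof.
have mE t : measurable_fun setT (fun w => expR (t * `|X w ord0 i|))%R.
  apply: measurableT_comp => //; apply: measurable_funM => //.
  apply: measurableT_comp => //.
  by apply: (measurableT_comp (measurable_coord i)); exact: measurable_input.
have [[K [cK PK]]|[nrm [nrmP [a a0 aoo]]]] := compact_or_exp_integrable hX.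
  have [M [Mreal /(_ (M + 1)%R)]] := compact_bounded cK.
  rewrite ltrDl ltr01 => /(_ isT) KM; exists 1%R => //.
  have mK : measurable (X @^-1` K).
    rewrite -[X in measurable X]setTI; apply: measurable_input => //.
    rewrite -[K]setCK; apply: measurableC; apply: open_measurable_rV.
    apply: closed_openC; apply: compact_closed => //; exact: norm_hausdorff.
  apply: (@le_lt_trans _ _ (\int[Pr]_w (expR (M + 1))%:E)).
    apply: ae_ge0_le_integral => //.
    - exact/measurable_EFinP.
    - exists (~` (X @^-1` K)); split; first exact: measurableC.
        by rewrite [LHS](probability_setC Pr mK) [X in (_ - X)%E]PK subee.
      move=> w /= nw Kw; apply: nw => _.
      rewrite lee_fin ler_expR mul1r.
      by apply: le_trans (coord_le_norm _ _) _; exact: KM.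
  by rewrite integral_cst//= probability_setT mule1 ltry.
have [c c0 cP] := coord_le_is_norm nrmP.
have mnrm : measurable_fun setT (fun x => expR (a * nrm x))%R.
  apply: measurableT_comp => //; apply: measurable_funM => //.
  exact: (continuous_rV_measurable_fun (continuous_is_norm nrmP)).
exists (a * c)%R; first exact: mulr_gt0.
move: aoo; rewrite -(ge0_expectation_density (g := fun x => expR (a * nrm x))%R)//.
apply: le_lt_trans; apply: ge0_le_integral => //.
- exact/measurable_EFinP.
- apply/measurable_EFinP; apply: (measurableT_comp mnrm); exact: measurable_input.
by move=> w _; rewrite lee_fin ler_expR -mulrA ler_pM2l.
Qed.

Theorem input_polynomials_dense (y : 'rV[R]_N -> R) : measurable_fun A y ->
  \int[Pr]_w ((y (X w) ^+ 2)%R)%:E < +oo ->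
  y \o X \in Lfun Pr 2%:E /\ L2closure Pr input_polynomials (y \o X).
Proof.
move=> my y2.
have AX := input_in_domain hX.
have yX : y \o X \in Lfun Pr 2%:E.
  apply/Lfun2P; split => //; apply: (measurable_comp mA _ my) => //.
  by move=> _ [w _ <-].
split => //; apply: (@L2closure_full _ _ _ _ _ _ _ _ _ N X A y) => //.
- exact: input_polynomials_L2.
- exact: input_polynomials_cst.
- exact: input_polynomialsD.
- exact: input_polynomialsM.
- move=> i; exists [:: (1%R, coord_index i)] => w.
  by rewrite /polynomial_of big_seq1 mul1r monomial_coord.
- exact: exp_moment.
Qed.

End admissible_input_theory.

(** * Best approximation by orthonormal families *)

Section inner_product.
Context {R : realType} {d : measure_display} {T : measurableType d}.
Variable Pr : probability T R.
Implicit Types f g h : T -> R.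

Definition inner f g : R := fine ('E_Pr[fun w => (f w * g w)%R])%E.

Let L2 f : Prop := f \in Lfun Pr 2%:E.

Lemma expectation_inner f g : L2 f -> L2 g ->
  ('E_Pr[fun w => (f w * g w)%R])%E = (inner f g)%:E.
Proof.
by move=> f2 g2; rewrite fineK// expectation_fin_num//; exact: Lfun2_mul_Lfun1.
Qed.

Lemma innerC f g : inner f g = inner g f.
Proof. by congr (fine ('E_Pr[_])%E); apply/funext => w; rewrite mulrC. Qed.

Lemma Lfun2D f g : L2 f -> L2 g -> L2 (fun w => f w + g w).
Proof.
have p1 : (1 <= 2%:E :> \bar R)%E by rewrite lee_fin ler1n.
by have [_] := Lfun_addr_closed Pr p1; exact.
Qed.

Lemma innerDl f g h : L2 f -> L2 g -> L2 h ->
  inner (fun w => f w + g w) h = inner f h + inner g h.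
Proof.
move=> f2 g2 h2; apply: EFin_inj; rewrite EFinD -!expectation_inner//; last first.
  exact: Lfun2D.
rewrite -expectationD//; do ?exact: Lfun2_mul_Lfun1.
by congr ('E_Pr[_])%E; apply/funext => w /=; rewrite mulrDl.
Qed.

Lemma Lfun2Z c f : L2 f -> L2 (fun w => c * f w).
Proof.
move=> f2; rewrite (_ : (fun w => _) = c \o* f).
  by apply: Lfun_scale => //; rewrite ler1n.
by apply/funext => w; rewrite /= mulrC.
Qed.

Lemma innerZl c f g : L2 f -> L2 g -> inner (fun w => c * f w) g = c * inner f g.
Proof.
move=> f2 g2; apply: EFin_inj; rewrite EFinM -!expectation_inner//; last first.
  exact: Lfun2Z.
rewrite -expectationZl; last exact: Lfun2_mul_Lfun1.
by congr ('E_Pr[_])%E; apply/funext => w /=; rewrite -mulrA mulrC.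
Qed.

Lemma Lfun2_sum (J : Type) (s : seq J) (P : pred J) (F : J -> T -> R) :
  (forall i, L2 (F i)) -> L2 (fun w => \sum_(i <- s | P i) F i w).
Proof.
move=> F2; elim: s => [|i s IH].
  rewrite (_ : (fun w => _) = cst 0); first exact: Lfun_cst.
  by apply/funext => w; rewrite big_nil.
case Pi : (P i); under eq_fun do rewrite big_cons Pi; last exact: IH.
exact: Lfun2D.
Qed.

Lemma inner_suml (J : Type) (s : seq J) (P : pred J) (c : J -> R)
    (F : J -> T -> R) g :
  (forall i, L2 (F i)) -> L2 g ->
  inner (fun w => \sum_(i <- s | P i) c i * F i w) g =
  \sum_(i <- s | P i) c i * inner (F i) g.
Proof.
move=> F2 g2; elim: s => [|i s IH].
  rewrite big_nil /inner (_ : (fun w => _) = cst 0) ?expectation_cst//.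
  by apply/funext => w; rewrite big_nil mul0r.
rewrite big_cons; case: ifPn => Pi; last first.
  by rewrite -IH; congr (fine ('E_Pr[_])%E); apply/funext => w;
    rewrite big_cons (negbTE Pi).
rewrite -IH -innerZl// -innerDl//; last 2 first.
- exact: Lfun2Z.
- by apply: (@Lfun2_sum _ s P (fun i w => c i * F i w)) => k; exact: Lfun2Z.
by congr (fine ('E_Pr[_])%E); apply/funext => w; rewrite big_cons Pi.
Qed.

Lemma inner_sqdist f g : L2 f -> L2 g ->
  sqdist Pr f g = (inner f f - 2 * inner f g + inner g g)%:E.
Proof.
move=> f2 g2; have Ng2 : L2 (fun w => -1 * g w) by exact: Lfun2Z.
have fg2 : L2 (fun w => f w + -1 * g w) by exact: Lfun2D.
rewrite (_ : sqdist Pr f g =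
    ('E_Pr[fun w => ((f w + -1 * g w) * (f w + -1 * g w))%R])%E); last first.
  by rewrite unlock; apply: eq_integral => w _; rewrite mulN1r expr2.
rewrite expectation_inner//; congr _%:E.
rewrite innerDl// innerZl// [inner f _]innerC [inner g (fun w => _ + _)]innerC.
rewrite !innerDl// !innerZl// (innerC g f); ring.
Qed.

Lemma expectation_inner1 f : L2 f -> ('E_Pr[f])%E = (inner f (cst 1))%:E.
Proof.
move=> f2; rewrite -expectation_inner//; last exact: Lfun_cst.
by congr ('E_Pr[_])%E; apply/funext => w; rewrite mulr1.
Qed.

Lemma variance_inner f : L2 f ->
  ('V_Pr[f])%E = (inner f f - inner f (cst 1) ^+ 2)%:E.
Proof.
move=> f2; rewrite varianceE// (expectation_inner1 f2) EFinB -(expectation_inner f2 f2).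
by congr (_ - _)%E.
Qed.

Section orthonormal_family.
Variables (I : finType) (psi : I -> T -> R).
Hypothesis psi_L2 : forall i, L2 (psi i).
Hypothesis psi_orthonormal : forall i j, inner (psi i) (psi j) = (i == j)%:R.

Lemma inner_orthonormal_sum (c : I -> R) j :
  inner (fun w => \sum_i c i * psi i w) (psi j) = c j.
Proof.
rewrite inner_suml// (bigD1 j)//= psi_orthonormal eqxx mulr1 big1 ?addr0//.
by move=> i ij; rewrite psi_orthonormal (negbTE ij) mulr0.
Qed.

Lemma orthonormal_sum_L2 (c : I -> R) : L2 (fun w => \sum_i c i * psi i w).
Proof. by apply: Lfun2_sum => i; exact: Lfun2Z. Qed.

Lemma orthonormal_parseval (c : I -> R) :
  let p w := \sum_i c i * psi i w in inner p p = \sum_i c i ^+ 2.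
Proof.
move=> p; rewrite {1}/p inner_suml//; last exact: orthonormal_sum_L2.
by apply: eq_bigr => i _; rewrite innerC inner_orthonormal_sum expr2.
Qed.

(** Completing the square: the coefficients inner y (psi i) minimize the distance,
    and the minimum is the defect in Bessel's inequality. *)
Lemma sqdist_orthonormal_sum y (c : I -> R) : L2 y ->
  sqdist Pr y (fun w => \sum_i c i * psi i w) =
  (inner y y - \sum_i inner y (psi i) ^+ 2
     + \sum_i (c i - inner y (psi i)) ^+ 2)%:E.
Proof.
move=> y2; rewrite inner_sqdist//; last exact: orthonormal_sum_L2.
congr _%:E; rewrite orthonormal_parseval innerC inner_suml// mulr_sumr.
rewrite -sumrN -addrA -big_split/= -sumrN -[RHS]addrA -big_split/=.
congr (_ + _); apply: eq_bigr => i _; rewrite [inner (psi i) y]innerC; ring.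
Qed.

End orthonormal_family.
End inner_product.

(** * Orthonormality and span of the chaos polynomials *)

Section orthonormal_polynomials.
Context {R : realType} {d : measure_display} {T : measurableType d}.
Context {Pr : probability T R} {N : nat} {X : {RV Pr >-> 'rV[R]_N}}.
Context {A : set 'rV[R]_N} {f : 'rV[R]_N -> R}.
Hypothesis hX : admissible_input X A f.
Context {le : rel (multi_index N)}.
Variable mi : forall l, 'I_(nb_idx N l) -> multi_index N.
Arguments mi : clear implicits.
Hypothesis mi_listing : graded_listing le mi.
Variable P : multi_index N -> 'rV[R]_N -> R.
Hypothesis P_orthogonal : orthogonal_polynomials mi A f P.
Variable W : forall l, 'M[R]_(nb_idx N l).
Arguments W : clear implicits.
Hypothesis W_whitening : whitening Pr X mi P W.
Implicit Types (j : multi_index N) (l r : nat).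

Let mono j w : R := monomial j (X w).
Let pol l i w : R := P (mi l i) (X w).
Arguments pol : clear implicits.
Let Psi l i x : R := orthonormal_col mi P W l x i ord0.
Arguments Psi : clear implicits.
Let psi l i w : R := Psi l i (X w).
Arguments psi : clear implicits.

Let mdegree_mi l i : mdegree (mi l i) = l.
Proof. by have [] := mi_listing l. Qed.

Let mi_onto j : exists i, mi (mdegree j) i = j.
Proof. by have [_ ontol _ _] := mi_listing (mdegree j); exact: ontol. Qed.

Let P_expand j : exists (s : seq (multi_index N)) (c : multi_index N -> R),
  (forall k, k \in s -> (mdegree k <= mdegree j)%N) /\
  forall x, P j x = \sum_(k <- s) c k * monomial k x.
Proof. by have [_ Psp _ _] := P_orthogonal; exact: Psp. Qed.

Let P_polynomial j : exists s, P j = polynomial_of s.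
Proof.
have [s [c [_ Pj]]] := P_expand j; exists [seq (c k, k) | k <- s].
by apply/funext => x; rewrite Pj /polynomial_of big_map.
Qed.

Let measurable_P j : measurable_fun setT (P j).
Proof. by have [s ->] := P_polynomial j; exact: measurable_polynomial_of. Qed.

Let mono_L2 j : mono j \in Lfun Pr 2%:E.
Proof.
apply: (input_polynomials_L2 hX); exists [:: (1, j)] => w.
by rewrite /polynomial_of big_seq1 mul1r.
Qed.

Let pol_L2 l i : pol l i \in Lfun Pr 2%:E.
Proof.
apply: (input_polynomials_L2 hX); have [s Ps] := P_polynomial (mi l i).
by exists s => w; rewrite /pol Ps.
Qed.

Let PsiE l k x : Psi l k x = \sum_i W l k i * P (mi l i) x.
Proof. by rewrite /Psi mxE; apply: eq_bigr => i _; rewrite mxE. Qed.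

Let psiE l k : psi l k = fun w => \sum_i W l k i * pol l i w.
Proof. by apply/funext => w; rewrite /psi PsiE. Qed.

Lemma orthonormal_col_L2 l k : psi l k \in Lfun Pr 2%:E.
Proof.
by rewrite psiE; apply: Lfun2_sum => i; apply: Lfun2Z; exact: pol_L2.
Qed.

(** Orthogonality is stated with Lebesgue integrals weighted by f, which are
    expectations by [expectation_density]. *)
Let inner_mono_pol j l i : (mdegree j < l)%N -> inner Pr (mono j) (pol l i) = 0.
Proof.
move=> jl; have [a aj] := mi_onto j.
have [_ _ /(_ _ _ jl)/matrixP/(_ a i) + _] := P_orthogonal.
rewrite !mxE => E; apply: etrans E.
rewrite /inner /Rintegral unlock; congr fine.
rewrite (expectation_density hX (g := fun x => monomial j x * P (mi l i) x)).
  by apply: eq_integral => x _; rewrite !mxE big_ord1 !mxE aj.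
by apply: measurable_funM => //; exact: measurable_monomial.
Qed.

Let inner_sum_mono_pol (s : seq (multi_index N)) (Q : pred (multi_index N)) c l i :
  (forall k, k \in s -> Q k -> (mdegree k < l)%N) ->
  inner Pr (fun w => \sum_(k <- s | Q k) c k * mono k w) (pol l i) = 0.
Proof.
move=> sl; rewrite inner_suml// big_seq_cond big1// => k /andP[ks Qk].
by rewrite inner_mono_pol ?mulr0// sl.
Qed.

Let inner_pol_pol r a l i : (r < l)%N -> inner Pr (pol r a) (pol l i) = 0.
Proof.
move=> rl; have [s [c [sdeg Pc]]] := P_expand (mi r a).
rewrite [X in inner Pr X _](_ : _ =
    fun w => \sum_(k <- s | xpredT k) c k * mono k w).
  apply: inner_sum_mono_pol => k ks _.
  by apply: leq_ltn_trans (sdeg _ ks) _; rewrite mdegree_mi.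
by apply/funext => w; rewrite /pol Pc.
Qed.

Let momentE l i k : moment_mx Pr X mi P l i k = inner Pr (pol l i) (pol l k).
Proof.
rewrite !mxE /inner; congr (fine ('E_Pr[_])%E); apply/funext => w.
by rewrite !mxE big_ord1 !mxE.
Qed.

Let W_unit l : W l \in unitmx.
Proof. by have [_ /(_ l)[]] := W_whitening. Qed.

(** W is invertible, hence so is W^T W, which is the inverse of the moment
    matrix. *)
Let moment_unit l : moment_mx Pr X mi P l \in unitmx.
Proof.
have [_ /(_ l)[_ WG]] := W_whitening.
by rewrite -unitmx_inv -WG unitmx_mul unitmx_tr W_unit.
Qed.

(** The whitening relation gives W^T W G W^T = W^T, and W^T can be cancelled. *)
Let whitened l : W l *m moment_mx Pr X mi P l *m (W l)^T = 1%:M.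
Proof.
have [_ /(_ l)[_ WG]] := W_whitening.
have WT : (W l)^T \in unitmx by rewrite unitmx_tr.
apply: (can_inj (mulKmx WT)); rewrite mulmx1 !mulmxA WG.
by rewrite mulVmx ?moment_unit// mul1mx.
Qed.

Let inner_psi_sum l a r b : inner Pr (psi l a) (psi r b) =
  \sum_i \sum_k W l a i * (W r b k * inner Pr (pol l i) (pol r k)).
Proof.
rewrite psiE inner_suml//; last exact: orthonormal_col_L2.
apply: eq_bigr => i _; rewrite innerC psiE inner_suml// mulr_sumr.
by apply: eq_bigr => k _; rewrite (innerC Pr (pol r k)).
Qed.

Lemma orthonormal_col_same_degree l a b :
  inner Pr (psi l a) (psi l b) = (a == b)%:R.
Proof.
rewrite inner_psi_sum; have /matrixP/(_ a b) := whitened l.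
rewrite !mxE => <-; rewrite exchange_big; apply: eq_bigr => k _.
rewrite !mxE mulr_suml; apply: eq_bigr => i _.
by rewrite momentE; ring.
Qed.

Lemma orthonormal_col_other_degree l r a b : l != r ->
  inner Pr (psi l a) (psi r b) = 0.
Proof.
rewrite neq_ltn inner_psi_sum => lr.
rewrite big1// => i _; rewrite big1// => k _.
case/orP: lr => lr; first by rewrite inner_pol_pol// !mulr0.
by rewrite innerC inner_pol_pol// !mulr0.
Qed.

Definition chaos_span (L : nat) : set ('rV[R]_N -> R) :=
  [set g | exists c : forall l, 'I_(nb_idx N l) -> R,
    forall x, g x = \sum_(l < L) \sum_k c l k * Psi l k x].

Let span0 L : chaos_span L (fun=> 0).
Proof.
exists (fun _ _ => 0) => x; rewrite big1// => l _; rewrite big1// => k _.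
by rewrite mul0r.
Qed.

Let spanD L g h : chaos_span L g -> chaos_span L h ->
  chaos_span L (fun x => g x + h x).
Proof.
move=> [c gc] [e he]; exists (fun l k => c l k + e l k) => x.
rewrite gc he -big_split; apply: eq_bigr => l _; rewrite -big_split.
by apply: eq_bigr => k _; rewrite mulrDl.
Qed.

Let spanZ L a g : chaos_span L g -> chaos_span L (fun x => a * g x).
Proof.
move=> [c gc]; exists (fun l k => a * c l k) => x.
rewrite gc mulr_sumr; apply: eq_bigr => l _; rewrite mulr_sumr.
by apply: eq_bigr => k _; rewrite mulrA.
Qed.

Let span_sum L (J : eqType) (s : seq J) (Q : pred J) (c : J -> R)
    (g : J -> 'rV[R]_N -> R) :
  (forall i, i \in s -> Q i -> chaos_span L (g i)) ->
  chaos_span L (fun x => \sum_(i <- s | Q i) c i * g i x).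
Proof.
elim: s => [_|i s IH sg].
  by under eq_fun do rewrite big_nil; exact: span0.
have sps : chaos_span L (fun x => \sum_(i <- s | Q i) c i * g i x).
  by apply: IH => k ks; apply: sg; rewrite inE ks orbT.
case Qi : (Q i); under eq_fun do rewrite big_cons Qi; last exact: sps.
by apply: spanD => //; apply: spanZ; apply: sg => //; rewrite inE eqxx.
Qed.

Let span_leq L M g : (L <= M)%N -> chaos_span L g -> chaos_span M g.
Proof.
move=> LM [c gc]; exists (fun l k => if (l < L)%N then c l k else 0) => x.
rewrite gc (big_ord_widen _ (fun l => \sum_k c l k * Psi l k x) LM) big_mkcond.
apply: eq_bigr => l _; case: ifP => lL //.
by rewrite big1// => k _; rewrite mul0r.
Qed.

Let span_Psi L l k : (l < L)%N -> chaos_span L (Psi l k).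
Proof.
move=> lL.
exists (fun r (i : 'I_(nb_idx N r)) => ((r == l) && (i == k :> nat))%:R) => x.
rewrite (bigD1 (Ordinal lL))//= [X in _ + X]big1 ?addr0; last first.
  move=> r; rewrite -val_eqE/= => /negbTE rl; rewrite big1// => i _.
  by rewrite rl mul0r.
rewrite (bigD1 k)//= !eqxx mul1r big1 ?addr0// => i.
by rewrite -val_eqE/= => /negbTE ik; rewrite ik /= mul0r.
Qed.

(** By induction on the degree. Let P_L = H x_L + low with low of degree less
    than L. Since P_L is orthogonal to low, its moment matrix is H S_L for
    S_L = E[x_L P_L^T]; as it is invertible, so is H. Therefore
    x_L = H^-1 (P_L - low), where P_L = W_L^-1 Psi_L and low is already in the
    span. *)
Lemma monomial_chaos_span L j : (mdegree j < L)%N -> chaos_span L (monomial j).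
Proof.
elim: L j => [//|L IH] j; rewrite ltnS leq_eqVlt => /orP[/eqP jL|jL]; last first.
  by apply: (span_leq (leqnSn L)); exact: IH.
have PSi i : {sc : seq (multi_index N) * (multi_index N -> R) |
    (forall k, k \in sc.1 -> (mdegree k <= L)%N) /\
    forall x, P (mi L i) x = \sum_(k <- sc.1) sc.2 k * monomial k x}.
  apply: cid; have [s [c [sdeg Pc]]] := P_expand (mi L i).
  by exists (s, c); split => // k /sdeg; rewrite mdegree_mi.
pose s i := (sval (PSi i)).1; pose c i := (sval (PSi i)).2.
have sdeg i : forall k, k \in s i -> (mdegree k <= L)%N.
  by have [] := svalP (PSi i).
have Pc i : forall x, P (mi L i) x = \sum_(k <- s i) c i k * monomial k x.
  by have [] := svalP (PSi i).
pose H : 'M[R]_(nb_idx N L) :=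
  \matrix_(i, k) \sum_(j' <- s i | j' == mi L k) c i j'.
pose low i x := \sum_(k <- s i | (mdegree k < L)%N) c i k * monomial k x.
have PH i x : P (mi L i) x = \sum_k H i k * monomial (mi L k) x + low i x.
  rewrite Pc (bigID (fun k => mdegree k < L)%N)/= addrC; congr (_ + _).
  under [RHS]eq_bigr do rewrite mxE mulr_suml big_mkcond.
  rewrite exchange_big/= [LHS]big_mkcond/=; apply: eq_big_seq => j' j's.
  have [j'L|Lj'] := ltnP (mdegree j') L.
    rewrite big1// => k _; case: eqP => // j'k.
    by move: j'L; rewrite j'k mdegree_mi ltnn.
  have j'L : mdegree j' = L by apply/eqP; rewrite eqn_leq (sdeg i _ j's).
  have [k0 k0j] : exists k0, mi L k0 = j' by rewrite -j'L; exact: mi_onto.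
  rewrite (bigD1 k0)//= k0j eqxx big1 ?addr0// => k kk0.
  have [_ _ mi_inj _] := mi_listing L.
  by case: eqP => // j'k; move: kk0; rewrite -(inj_eq mi_inj) -j'k k0j eqxx.
have low_span i : chaos_span L (low i).
  by apply: span_sum => k _; exact: IH.
have Hunit : H \in unitmx.
  suff: moment_mx Pr X mi P L =
      H *m \matrix_(k, i) inner Pr (mono (mi L k)) (pol L i).
    by move=> E; have := moment_unit L; rewrite E unitmx_mul => /andP[].
  apply/matrixP => i i'; rewrite momentE !mxE.
  rewrite [X in inner Pr X _](_ : _ = fun w => \sum_k H i k * mono (mi L k) w +
      \sum_(k <- s i | (mdegree k < L)%N) c i k * mono k w); last first.
    by apply/funext => w; rewrite /pol PH.
  rewrite innerDl//; last 2 first.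
  - by apply: Lfun2_sum => k; exact: Lfun2Z.
  - by apply: Lfun2_sum => k; exact: Lfun2Z.
  rewrite [X in _ + X]inner_sum_mono_pol// addr0 inner_suml//.
  by apply: eq_bigr => k _; rewrite !mxE.
have [k0 k0j] : exists k0, mi L k0 = j by rewrite -jL; exact: mi_onto.
have monoE x : monomial (mi L k0) x = \sum_i invmx H k0 i *
    (\sum_k invmx (W L) i k * Psi L k x + -1 * low i x).
  have Px : (\col_i P (mi L i) x) = invmx (W L) *m \col_k Psi L k x.
    apply: (can_inj (mulKmx (W_unit L))); rewrite mulmxA mulmxV ?W_unit// mul1mx.
    by apply/matrixP => i k; rewrite [RHS]mxE PsiE mxE;
      apply: eq_bigr => a _; rewrite !mxE.
  have Hx : H *m (\col_k monomial (mi L k) x) =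
      (\col_i P (mi L i) x) - \col_i low i x.
    apply/matrixP => i k; rewrite !mxE PH addrK.
    by apply: eq_bigr => a _; rewrite !mxE.
  have := congr1 (fun M => (invmx H *m M) k0 ord0) Hx.
  rewrite mulmxA mulVmx// mul1mx mxE => ->; rewrite mxE Px.
  apply: eq_bigr => i _; rewrite !mxE mulN1r; congr (_ * (_ - _)).
  by apply: eq_bigr => a _; rewrite !mxE.
rewrite -k0j (funext monoE).
apply: span_sum => i _ _; apply: spanD.
  by apply: span_sum => k _ _; exact: span_Psi.
by apply: spanZ; apply: (span_leq (leqnSn L)).
Qed.

Lemma polynomial_chaos_span s : exists m, chaos_span m.+1 (polynomial_of s).
Proof.
exists (\max_(c <- s) mdegree c.2).
apply: (@span_sum _ _ s xpredT (fun c => c.1) (fun c => monomial c.2)) => c cs _.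
apply: monomial_chaos_span; rewrite ltnS.
exact: (@leq_bigmax_seq _ s xpredT (fun c => mdegree c.2)).
Qed.

End orthonormal_polynomials.

(** * Means and variances of the expansion *)

Section chaos_expansion_moments.
Context {R : realType} {d : measure_display} {T : measurableType d}.
Context {Pr : probability T R} {N : nat} {X : {RV Pr >-> 'rV[R]_N}}.
Context {A : set 'rV[R]_N} {f : 'rV[R]_N -> R}.
Hypothesis hX : admissible_input X A f.
Context {le : rel (multi_index N)}.
Variable mi : forall l, 'I_(nb_idx N l) -> multi_index N.
Arguments mi : clear implicits.
Hypothesis mi_listing : graded_listing le mi.
Variable P : multi_index N -> 'rV[R]_N -> R.
Hypothesis P_orthogonal : orthogonal_polynomials mi A f P.
Variable W : forall l, 'M[R]_(nb_idx N l).
Arguments W : clear implicits.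
Hypothesis W_whitening : whitening Pr X mi P W.
Variable y : 'rV[R]_N -> R.
Hypothesis y_measurable : measurable_fun A y.
Hypothesis y_L2 : (\int[Pr]_w ((y (X w) ^+ 2)%R)%:E < +oo)%E.

Let psi l i w : R := orthonormal_col mi P W l (X w) i ord0.
Arguments psi : clear implicits.
Let Y := y \o X.
Let Y_L2 : Y \in Lfun Pr 2%:E.
Proof. by have [] := input_polynomials_dense hX y_measurable y_L2. Qed.

Let psi_L2 l i : psi l i \in Lfun Pr 2%:E.
Proof. exact: (orthonormal_col_L2 hX P_orthogonal). Qed.

Let C l i := inner Pr Y (psi l i).
Arguments C : clear implicits.
Let energy l := pce_energy Pr X mi P W y l.

Let coefE l i : pce_coef Pr X mi P W y l i ord0 = C l i.
Proof.
by rewrite mxE; congr (fine ('E_Pr[_])%E); apply/funext => w; rewrite mxE.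
Qed.

Let energyE l : energy l = \sum_i C l i ^+ 2.
Proof.
by rewrite /energy /pce_energy mxE; apply: eq_bigr => i _; rewrite mxE coefE expr2.
Qed.

(** The pairs (l, i) number the components of Psi_0, ..., Psi_m, so that the
    results on finite orthonormal families apply. *)
Let degree_le m : finType := {l : 'I_m.+1 & 'I_(nb_idx N l)}.
Let psi_le m (p : degree_le m) := psi (tag p) (tagged p).

Let psi_le_L2 m p : @psi_le m p \in Lfun Pr 2%:E.
Proof. exact: psi_L2. Qed.

Let psi_le_orthonormal m p q : inner Pr (@psi_le m p) (psi_le q) = (p == q)%:R.
Proof.
case: p q => [l a] [r b]; rewrite /psi_le/=.
have [lr|lr] := eqVneq l r.
  subst r; rewrite eq_Tagged/=.
  exact: (orthonormal_col_same_degree hX P_orthogonal W_whitening).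
rewrite -tag_eqE /tag_eq/= (negbTE lr)/=.
exact: (orthonormal_col_other_degree hX mi_listing P_orthogonal).
Qed.

Let pceE m w : pce Pr X mi P W y m (X w) =
  \sum_(p : degree_le m) inner Pr Y (psi_le p) * psi_le p w.
Proof.
rewrite /pce -(@sig_big_dep _ _ _ _ _ xpredT (fun _ => xpredT)
  (fun l k => C (val l) k * psi (val l) k w))/=.
apply: eq_bigr => l _; rewrite mxE; apply: eq_bigr => k _.
by rewrite mxE coefE.
Qed.

Let partial_energy m := \sum_(l < m.+1) energy l.

Let partial_energyE m :
  partial_energy m = \sum_(p : degree_le m) inner Pr Y (psi_le p) ^+ 2.
Proof.
rewrite -(@sig_big_dep _ _ _ _ _ xpredT (fun _ => xpredT)
  (fun l k => C (val l) k ^+ 2))/=.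
by apply: eq_bigr => l _; rewrite energyE.
Qed.

Lemma bessel_inequality m : partial_energy m <= inner Pr Y Y.
Proof.
have := sqdist_orthonormal_sum (@psi_le_L2 m) (@psi_le_orthonormal m)
  (fun p => inner Pr Y (psi_le p)) Y_L2.
rewrite [X in _ + X]big1; last by move=> p _; rewrite subrr expr0n.
rewrite addr0 -partial_energyE => E.
have : (0 <= sqdist Pr Y (fun w =>
    (\sum_p inner Pr Y (psi_le p) * @psi_le m p w)%R))%E.
  by apply: integral_ge0 => w _; rewrite lee_fin sqr_ge0.
by rewrite E lee_fin subr_ge0.
Qed.

(** A polynomial p with E[(Y - p(X))^2] < e is a combination of Psi_0, ..., Psi_m
    for some m, and y_m is at least as close to Y as p(X). *)
Lemma partial_energy_approx e : 0 < e ->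
  exists m, inner Pr Y Y - partial_energy m < e.
Proof.
move=> e0; have [_ [_ /(_ e e0)[p [s ps] pe]]] :=
  input_polynomials_dense hX y_measurable y_L2.
have [m [c sc]] := polynomial_chaos_span hX mi_listing P_orthogonal W_whitening s.
exists m; move: pe.
rewrite (_ : p = fun w => \sum_(q : degree_le m) c (tag q) (tagged q) * psi_le q w).
  rewrite (sqdist_orthonormal_sum (@psi_le_L2 m) (@psi_le_orthonormal m))//.
  rewrite lte_fin -partial_energyE; apply: le_lt_trans.
  by rewrite lerDl sumr_ge0// => q _; exact: sqr_ge0.
apply/funext => w; rewrite ps sc.
by rewrite -(@sig_big_dep _ _ _ _ _ xpredT (fun _ => xpredT)
  (fun l k => c (val l) k * psi (val l) k w)).
Qed.

(** Parseval's identity: the partial energies increase and are bounded by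
    Bessel's inequality. *)
Lemma cvg_partial_energy : partial_energy m @[m --> \oo] --> inner Pr Y Y.
Proof.
apply/cvgrPdist_lt => e e0; have [m me] := partial_energy_approx e0.
exists m => // n /= mn; rewrite ger0_norm ?subr_ge0 ?bessel_inequality//.
apply: le_lt_trans me; rewrite lerD2l lerN2.
rewrite /partial_energy -!(big_mkord xpredT energy).
rewrite [leRHS](big_cat_nat _ (n := m.+1))//= lerDl sumr_ge0// => l _.
by rewrite energyE sumr_ge0// => i _; exact: sqr_ge0.
Qed.

Let i0 : 'I_(nb_idx N 0) := cast_ord (esym (nb_idx0 N)) ord0.

(** There is a single multi-index of degree 0. *)
Let eq_i0 i : i = i0.
Proof.
by apply: val_inj => /=; have := ltn_ord i; rewrite {2}nb_idx0; case: (val i).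
Qed.

Lemma orthonormal_col0 i : psi 0 i = cst 1.
Proof.
have [P0 _ _ _] := P_orthogonal; have [W0 _] := W_whitening.
apply/funext => w; rewrite /psi /orthonormal_col W0 mul1mx mxE.
rewrite (_ : mi 0 i = 0) ?P0//.
have [mi0 _ _ _] := mi_listing 0; have /eqP := mi0 i.
rewrite sum_nat_eq0 => /forallP mi0i; apply/ffunP => k.
by rewrite ffunE; exact/eqP/mi0i.
Qed.

Let coef0E : pce_coef0 Pr X mi P W y = inner Pr Y (cst 1).
Proof. by rewrite /pce_coef0 coefE /C orthonormal_col0. Qed.

Let energy0 : energy 0 = inner Pr Y (cst 1) ^+ 2.
Proof.
rewrite energyE (bigD1 i0)//= big1 ?addr0; first by rewrite /C orthonormal_col0.
by move=> i; rewrite (eq_i0 i) eqxx.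
Qed.

Let Ym m w := pce Pr X mi P W y m (X w).

Let Ym_L2 m : Ym m \in Lfun Pr 2%:E.
Proof.
rewrite (funext (pceE m) : Ym m = _); exact: orthonormal_sum_L2.
Qed.

Let inner_Ym1 m : inner Pr (Ym m) (cst 1) = inner Pr Y (cst 1).
Proof.
rewrite (funext (pceE m) : Ym m = _) -(orthonormal_col0 i0).
by rewrite (inner_orthonormal_sum (@psi_le_L2 m) (@psi_le_orthonormal m) _
  (Tagged (fun l : 'I_m.+1 => 'I_(nb_idx N l))
    (i0 : 'I_(nb_idx N (ord0 : 'I_m.+1))))).
Qed.

Lemma expectation_pce m : ('E_Pr[Ym m])%E = ('E_Pr[Y])%E.
Proof. by rewrite !expectation_inner1 ?Ym_L2// inner_Ym1. Qed.

Lemma expectation_output : ('E_Pr[Y])%E = (pce_coef0 Pr X mi P W y)%:E.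
Proof. by rewrite expectation_inner1// coef0E. Qed.

Lemma variance_pce m : ('V_Pr[Ym m])%E = (partial_energy m - energy 0)%:E.
Proof.
rewrite variance_inner ?Ym_L2// inner_Ym1 energy0 partial_energyE.
by rewrite (funext (pceE m) : Ym m = _) orthonormal_parseval.
Qed.

Lemma variance_pce_sum m :
  ('V_Pr[Ym m])%E = (\sum_(1 <= l < m.+1) (energy l)%:E)%E.
Proof.
rewrite variance_pce sumEFin /partial_energy -(big_mkord xpredT energy).
by rewrite big_ltn// addrAC subrr add0r.
Qed.

Lemma cvg_variance_pce : (('V_Pr[Ym m])%E @[m --> \oo] --> ('V_Pr[Y])%E)%classic.
Proof.
rewrite variance_inner// -energy0; under eq_fun do rewrite variance_pce.
apply: cvg_EFin; first exact: nearW.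
by apply: cvgB; [exact: cvg_partial_energy|exact: cvg_cst].
Qed.

Lemma variance_output : ('V_Pr[Y])%E = (\sum_(1 <= l <oo) (energy l)%:E)%E.
Proof.
apply/esym/cvg_lim => //; rewrite -cvg_shiftS.
by have := cvg_variance_pce; under eq_fun do rewrite variance_pce_sum.
Qed.

End chaos_expansion_moments.

Local Open Scope ereal_scope.

Theorem mainTheorem5 (R : realType) (d : measure_display)
    (T : measurableType d) (Pr : probability T R)
    (Pr_complete : measure_is_complete Pr)
    (N : nat) (N_gt0 : (0 < N)%N)
    (X : {RV Pr >-> 'rV[R]_N}) (A : set 'rV[R]_N) (f : 'rV[R]_N -> R)
    (hX : admissible_input X A f)
    (le : rel (multi_index N)) (le_order : monomial_order le)
    (mi : forall l, 'I_(nb_idx N l) -> multi_index N)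
    (mi_listing : graded_listing le mi)
    (P : multi_index N -> 'rV[R]_N -> R)
    (P_orthogonal : orthogonal_polynomials mi A f P)
    (W : forall l, 'M[R]_(nb_idx N l))
    (W_whitening : whitening Pr X mi P W)
    (y : 'rV[R]_N -> R) (y_measurable : measurable_fun A y)
    (y_L2 : 'E_Pr[fun w => (y (X w) ^+ 2)%R] < +oo) :
  [/\ forall m : nat,
        'E_Pr[fun w => pce Pr X mi P W y m (X w)] = 'E_Pr[fun w => y (X w)],
      'E_Pr[fun w => y (X w)] = (pce_coef0 Pr X mi P W y)%:E,
      forall m : nat,
        'V_Pr[fun w => pce Pr X mi P W y m (X w)] =
          \sum_(1 <= l < m.+1) (pce_energy Pr X mi P W y l)%:E,
      'V_Pr[fun w => y (X w)] =
        \sum_(1 <= l <oo) (pce_energy Pr X mi P W y l)%:E &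
      'V_Pr[fun w => pce Pr X mi P W y m (X w)] @[m --> \oo]
        --> 'V_Pr[fun w => y (X w)]].

Proof.
have yL2 : \int[Pr]_w ((y (X w) ^+ 2)%R)%:E < +oo.
  by move: y_L2; rewrite unlock.
split.
- exact: (expectation_pce hX mi_listing P_orthogonal W_whitening y_measurable yL2).
- exact: (expectation_output hX mi_listing P_orthogonal W_whitening y_measurable yL2).
- exact: (variance_pce_sum hX mi_listing P_orthogonal W_whitening y).
- exact: (variance_output hX mi_listing P_orthogonal W_whitening y_measurable yL2).
- exact: (cvg_variance_pce hX mi_listing P_orthogonal W_whitening y_measurable yL2).
Qed.
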